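(* Let $\Omega$ be the partial functional such that $\Omega(X)$ is defined for sets $X$ with $|X|\le 1$ and outputs a finite sequence that includes all elements of $X$. No total functional $\Phi$ of type $3$ is computationally equivalent to $\Omega$, assuming $\exists^2$; that is, there is no total $\Phi$ of type $3$ such that $\Phi$ is computable in $\Omega$ and $\exists^2$, and $\Omega$ is computable in $\Phi$ and $\exists^2$.
   Context: $\exists^2:\mathbb N^{\mathbb N}\to\{0,1\}$ is defined by $\exists^2(f)=0$ iff $f(n)=0$ for some $n\in\mathbb N$. The sets $X$ are subsets of $\mathbb N^{\mathbb N}$ (or of $2^{\mathbb N}$, $[0,1]$, $\mathbb R$; this is immaterial in the presence of $\exists^2$), given by characteristic functions. Types: $0$ is a type of rank $0$; if $\sigma_1,\dots,\sigma_n$ ($n\ge 1$) are types, then $(\sigma_1,\dots,\sigma_n\to 0)$ is a type of rank $\max_i(\mathrm{rank}(\sigma_i)+1)$; pure types are given by $k+1=(k\to 0)$. Put $F(0)=\mathbb N$ and let $F(\sigma_1,\dots,\sigma_n\to 0)$ be the set of all total functions $F(\sigma_1)\times\cdots\times F(\sigma_n)\to\mathbb N$. Let $P(\sigma_1,\dots,\sigma_n\to 0)$ be the set of all functions $F(\sigma_1)\times\cdots\times F(\sigma_n)\to\mathbb N\cup\{\bot\}$, where $\bot$ means undefined (partial functionals, applied only to total arguments). A functional is total if it never takes the value $\bot$. Functionals with values in $\mathbb N^{\mathbb N}$, or in objects coded by elements of $\mathbb N^{\mathbb N}$, are viewed as $\mathbb N$-valued functionals with an extra number argument. Computability: Kleene's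 S1–S9, where partial functionals of type rank $\le 3$ are allowed as oracles. That is, $\{e\}(\vec\phi)\simeq a$ is the least relation closed under Kleene's schemes: successor, constants, projection to a number argument, composition, primitive recursion, permutation of arguments, application of an argument, and S9: $\{e\}(m,\vec\phi,\vec\psi)\simeq\{m\}(\vec\phi)$. An application $\phi_i(\lambda\vec\xi_1.\{d_1\}(\vec\xi_1,\vec\phi),\dots,\lambda\vec\xi_k.\{d_k\}(\vec\xi_k,\vec\phi))$ has value $a\in\mathbb N$ iff all the displayed functionals are total (on total arguments) and $\phi_i$ applied to them equals $a$. A partial functional $\psi$ is computable in $\vec\phi$ if for some $e$, $\{e\}(\vec\xi,\vec\phi)\simeq\psi(\vec\xi)$ for all total $\vec\xi$ with $\psi(\vec\xi)\ne\bot$. *)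

(* Defs.v *)
From Stdlib Require List.
From mathcomp Require Import all_boot.
From mathcomp.classical Require Import boolp.
Set Implicit Arguments.
Unset Strict Implicit.
Unset Printing Implicit Defensive.

(* Every type is uniquely s1 ⇒ (s2 ⇒ ... (sn ⇒ TN)), which stands for
   (s1, ..., sn -> 0); it is the type 0 when n = 0. *)
Inductive ty : Type := TN | Arr of ty & ty.

Declare Scope ty_scope.
Delimit Scope ty_scope with ty.
Bind Scope ty_scope with ty.
Notation "s ⇒ t" := (Arr s t) (at level 55, right associativity) : ty_scope.

Fixpoint pure (k : nat) : ty := if k is k'.+1 then (pure k' ⇒ TN)%ty else TN.

(* Tot s and Par s are the sets F(s) and P(s), in curried form; None is the
   undefined value. *)
Fixpoint Tot (s : ty) : Type := if s is Arr s t then Tot s -> Tot t else nat.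

Fixpoint Par (s : ty) : Type :=
  if s is Arr s t then Tot s -> Par t else option nat.

(* F(s1) * ... * F(sn) for s = (s1, ..., sn -> 0). *)
Fixpoint Inputs (s : ty) : Type :=
  if s is Arr s t then (Tot s * Inputs t)%type else unit.

Fixpoint tapp (s : ty) : Tot s -> Inputs s -> nat :=
  match s with
  | TN => fun f _ => f
  | Arr _ _ => fun f x => tapp (f x.1) x.2
  end.

Fixpoint papp (s : ty) : Par s -> Inputs s -> option nat :=
  match s with
  | TN => fun p _ => p
  | Arr _ _ => fun p x => papp (p x.1) x.2
  end.

Fixpoint tot (s : ty) : Tot s -> Par s :=
  match s with
  | TN => fun f => Some f
  | Arr _ _ => fun f x => tot (f x)
  end.

Definition is_total (s : ty) (p : Par s) : Prop := forall x, papp p x <> None.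

Arguments is_total s p : clear implicits.

Definition arg : Type := {s : ty & Par s}.

Definition oracle (s : ty) (p : Par s) : arg := existT Par s p.

Arguments oracle s p : clear implicits.

Definition num (n : nat) : arg := oracle TN (Some n).

Fixpoint inputs (s : ty) : Inputs s -> seq {t : ty & Tot t} :=
  match s with
  | TN => fun=> [::]
  | Arr s _ => fun x => existT Tot s x.1 :: inputs x.2
  end.

Definition args (s : ty) (x : Inputs s) : seq arg :=
  [seq oracle _ (tot (projT2 f)) | f <- inputs x].

(* Indices are numbers coding finite sequences, headed by the number of the
   scheme. *)
Notation "⟪ s ⟫" := (CodeSeq.code s) (at level 0, format "⟪ s ⟫").

(* Kleene's relation {e}(phis) = a.  As the schemes refer to the leading
   arguments, S6 is what gives access to the others.  kleene_app is
   the application of the i-th argument p (both S7 and S8): the j-th functional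
   fed to p, computed by the j-th index in ds, has to be total. *)
Inductive kleene : nat -> seq arg -> nat -> Prop :=
| kleene_succ n phis :
    kleene ⟪[:: 1]⟫ (num n :: phis) n.+1
| kleene_const q phis :
    kleene ⟪[:: 2; q]⟫ phis q
| kleene_proj n phis :
    kleene ⟪[:: 3]⟫ (num n :: phis) n
| kleene_comp d1 d2 phis b a :
    kleene d2 phis b ->
    kleene d1 (num b :: phis) a ->
    kleene ⟪[:: 4; d1; d2]⟫ phis a
| kleene_rec0 d1 d2 phis a :
    kleene d1 phis a ->
    kleene ⟪[:: 5; d1; d2]⟫ (num 0 :: phis) a
| kleene_recS d1 d2 n phis b a :
    kleene ⟪[:: 5; d1; d2]⟫ (num n :: phis) b ->
    kleene d2 (num n :: num b :: phis) a ->
    kleene ⟪[:: 5; d1; d2]⟫ (num n.+1 :: phis) a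
| kleene_perm d (pi : seq nat) phis a :
    perm_eq pi (iota 0 (size phis)) ->
    kleene d [seq nth (num 0) phis i | i <- pi] a ->
    kleene ⟪[:: 6, d & pi]⟫ phis a
| kleene_app i (ds : seq nat) s t (p : Par (s ⇒ t)) (x : Inputs (s ⇒ t)) phis a :
    onth phis i = Some (oracle (s ⇒ t) p) ->
    size ds = size (inputs x) ->
    (forall j d r (g : Tot r),
       onth ds j = Some d -> onth (inputs x) j = Some (existT Tot r g) ->
       forall xi : Inputs r, kleene d (args xi ++ phis) (tapp g xi)) ->
    papp p x = Some a ->
    kleene ⟪[:: 8, i & ds]⟫ phis a
| kleene_S9 m phis psis a :
    kleene m phis a ->
    kleene ⟪[:: 9; size phis]⟫ (num m :: phis ++ psis) a.

Definition computable_in (s : ty) (psi : Par s) (phis : seq arg) : Prop :=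
  exists e : nat, forall (xi : Inputs s) (a : nat),
    papp psi xi = Some a -> kleene e (args xi ++ phis) a.

Arguments computable_in s psi phis : clear implicits.

Definition E2 : Par (pure 2) :=
  fun f : nat -> nat => Some (if `[< exists n, f n = 0 >] then 0 else 1).

(* Sets of elements of Baire space are given by characteristic functions. *)
Definition is_set (X : Tot (pure 2)) : Prop := forall f, X f = 0 \/ X f = 1.

Definition at_most_one (X : Tot (pure 2)) : Prop :=
  forall f g, X f = 1 -> X g = 1 -> f = g.

(* The length of s, followed by the interleaving of the entries of s. *)
Definition seqcode (s : seq (nat -> nat)) (n : nat) : nat :=
  if n is k.+1 then nth (fun=> 0) s (k %% size s) (k %/ size s) else size s.

Definition elements (X : Tot (pure 2)) : seq (nat -> nat) :=
  if pselect (exists f, X f = 1) is left h then [:: projT1 (cid h)] else [::].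

Lemma elementsP (X : Tot (pure 2)) : at_most_one X ->
  forall f, X f = 1 <-> List.In f (elements X).
Proof.
rewrite /elements => hX f; case: pselect => [h|nh] /=.
  case: (cid h) => g Xg /=; split=> [Xf|[<-//|//]].
  by left; apply: hX.
by split=> // Xf; case: nh; exists f.
Qed.

(* Omega(X) lists the elements of X and nothing else.  The list must not carry
   further entries depending on X: an arbitrary h could then be hidden
   in Omega({f}) = <f, h(f)>. *)
Definition Omega : Par (pure 2 ⇒ TN ⇒ TN) :=
  fun (X : Tot (pure 2)) (n : nat) =>
    if `[< is_set X /\ at_most_one X >] then Some (seqcode (elements X) n)
    else None.

(* Main.v *)
From HB Require Import structures.
Require Import Defs.
From mathcomp Require Import all_boot.
From mathcomp.classical Require Import boolp.

(** A total functional Phi computable in Omega and E2 is countably based: Phi F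
    depends only on the values of F at countably many points, which may
    themselves depend on F ([countably_based]). A countably based functional
    cannot compute Omega. Indeed, start with the empty set as argument and close
    a countable set N of reals under the functions computed with parameters in
    N, and under bases for the calls of Phi made with parameters in N. If f is
    not in N, then the computation for the singleton of f agrees with the one for
    the empty set; but Omega has to return lists of different lengths.

    The difficulty in proving that Phi is countably based is a call of Omega whose
    set is empty for F but has an element for other functions that agree with F on
    the points inspected so far. Two facts exclude this. First, Phi is total, so
    that the call is defined for all functions which agree with F on a suitable
    countable set: it is enough to find two compatible countable pieces of
    functions that put different elements into the set. Secondly, Omega and E2 are,
    in effect, too weak to tell a wellfounded tree from an illfounded one, so that such
    pieces can be found.

    In detail, a good structure is a countable set of reals, with values of a
    type-2 function at them and a set of claimed evaluations closed under the
    schemes, where functions range over the structure only. The main statement,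
    [forced], is that a computation which converges for all extensions of a
    countable condition p has its value claimed by every good structure compatible
    with p. It is proved by induction on the computation, while p is allowed to
    grow; this induction is wellfounded because increasing sequences of countable
    conditions have unions ([below_acc]). A real h in the set of a call of Omega is
    then certified by a good structure which does not claim that h is outside the
    set. If a good structure x thinks that the set is empty, the certificates are
    the branches of a tree given by finitely many parameters in x. If one of the
    certified reals is not in x, branches can be built which avoid any countable set
    of reals outside x, and two such branches give the contradiction ([basis],
    [empty_call]).

    Building these branches requires x to be closed under the unique values taken on
    branches of such trees, and under sets of constraints that minimize the ranks of
    the trees. As good structures do not recognize wellfoundedness, both properties
    are expressed through tables that compare ranks: a table satisfying the recursive
    equation for the comparison is correct whenever one of the two trees is
    wellfounded ([comparison_le], [comparison_gt]). So goodness is an arithmetical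
    property, certificates form an analytic set, and there is a tree for it
    ([tree_table]). Good structures exist by a Loewenheim-Skolem argument
    ([skolem]). *)

Set Implicit Arguments.
Unset Strict Implicit.
Unset Printing Implicit Defensive.

(** * Evaluation over the reals and over countable structures *)

Notation baire := (nat -> nat).

(** The arguments that occur in a computation: numbers, functions, the type-2
    argument, E2, and one functional of type 3 (Omega or Phi). Functions are
    named by the elements of A: by themselves when A is Baire space, by
    indices of an enumeration when a countable structure evaluates. *)
Inductive item (A : Type) := ANum of nat | AFun of A | ATwo | AE2 | AThree.
Arguments ANum {A}.
Arguments ATwo {A}.
Arguments AE2 {A}.
Arguments AThree {A}.

Definition item_code A (t : item A) : nat + A + nat :=
  match t with
  | ANum n => inl (inl n)
  | AFun x => inl (inr x)
  | ATwo => inr 0 | AE2 => inr 1 | AThree => inr 2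
  end.

Definition item_decode A (c : nat + A + nat) : item A :=
  match c with
  | inl (inl n) => ANum n
  | inl (inr x) => AFun x
  | inr 0 => ATwo | inr 1 => AE2 | inr _ => AThree
  end.

Lemma item_codeK A : cancel (@item_code A) (@item_decode A).
Proof. by case. Qed.

HB.instance Definition _ (A : countType) :=
  Countable.copy (item A) (can_type (@item_codeK A)).

Definition item_map A B (f : A -> B) (t : item A) : item B :=
  match t with
  | ANum n => ANum n
  | AFun x => AFun (f x)
  | ATwo => ATwo | AE2 => AE2 | AThree => AThree
  end.

Definition callrel A := nat -> seq (item A) -> nat -> Prop.

Inductive instr :=
  | ISucc | IConst of nat | IProj | IComp of nat & nat | IRec of nat & nat
  | IPerm of nat & seq nat | IApp of nat & seq nat | IS9 of nat | IBad.

Definition instr_of (e : nat) : instr :=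
  match CodeSeq.decode e with
  | [:: 1] => ISucc
  | [:: 2; q] => IConst q
  | [:: 3] => IProj
  | [:: 4; d1; d2] => IComp d1 d2
  | [:: 5; d1; d2] => IRec d1 d2
  | [:: 6, d & pi] => IPerm d pi
  | [:: 8, i & ds] => IApp i ds
  | [:: 9; k] => IS9 k
  | _ => IBad
  end.

Definition E2fun (g : baire) : nat := if `[< exists n, g n = 0 >] then 0 else 1.

Section Step.
Variables (A : Type) (member : A -> baire) (member_value : A -> nat).
Variable (app3 : callrel A -> seq nat -> seq (item A) -> nat -> Prop).
Implicit Types (R : callrel A) (env : seq (item A)).

(** An argument of type 1 must be named by an element of A. Over Baire space
    this is no restriction; for good structures it is what [argument_in] is
    about. *)
Definition app_step R env (it : option (item A)) (ds : seq nat) (a : nat) :=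
  match it, ds with
  | Some (AFun j), [:: d] => exists2 b, R d env b & a = member j b
  | Some ATwo, [:: d] =>
      exists2 j, (forall n, R d (ANum n :: env) (member j n)) & a = member_value j
  | Some AE2, [:: d] =>
      exists2 j, (forall n, R d (ANum n :: env) (member j n)) & a = E2fun (member j)
  | Some AThree, _ => app3 R ds env a
  | _, _ => False
  end.

(** One application of a scheme, with the premises taken from R. Evaluation is
    the least fixed point over the reals, while a countable structure carries
    an arbitrary relation closed under this operator. The latter is an
    arithmetical condition, which the least fixed point over the structure
    would not be. *)
Definition step R (e : nat) env (a : nat) : Prop :=
  match instr_of e with
  | ISucc => if env is ANum n :: _ then a = n.+1 else False
  | IConst q => a = q
  | IProj => if env is ANum n :: _ then a = n else False
  | IComp d1 d2 => exists2 b, R d2 env b & R d1 (ANum b :: env) a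
  | IRec d1 d2 =>
      match env with
      | ANum 0 :: env' => R d1 env' a
      | ANum n.+1 :: env' =>
          exists2 b, R e (ANum n :: env') b & R d2 (ANum n :: ANum b :: env') a
      | _ => False
      end
  | IPerm d pi =>
      perm_eq pi (iota 0 (size env)) /\ R d [seq nth (ANum 0) env i | i <- pi] a
  | IApp i ds => app_step R env (onth env i) ds a
  | IS9 k =>
      if env is ANum m :: env' then k <= size env' /\ R m (take k env') a
      else False
  | IBad => False
  end.

(** The two ways in which Omega can answer, written so that the clause makes
    sense over any family of functions: some j0 is in the set and all others
    are out, or all are out. *)
Definition omega_app R ds env a : Prop :=
  if ds is [:: d1; d2] then
    exists2 n, R d2 env n &
      (exists2 j0, R d1 (AFun j0 :: env) 1 &
         (forall j, R d1 (AFun j :: env) 0 \/ member j = member j0) /\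
         a = seqcode [:: member j0] n)
      \/ ((forall j, R d1 (AFun j :: env) 0) /\ a = seqcode [::] n)
  else False.

End Step.

Section Ev.
Variables (F : baire -> nat).
Variable (app3 : callrel baire -> seq nat -> seq (item baire) -> nat -> Prop).

(** The least fixed point of step, with a relation R below it as the set of
    premises of the last rule, so that one constructor covers all schemes. *)
Inductive ev (e : nat) (env : seq (item baire)) (a : nat) : Prop :=
  Ev R of (forall e' env' a', R e' env' a' -> ev e' env' a')
        & step id F app3 R e env a.

Definition app_mono := forall (R R' : callrel baire) ds env a,
  (forall e' env' a', R e' env' a' -> R' e' env' a') ->
  app3 R ds env a -> app3 R' ds env a.

Lemma step_mono (R R' : callrel baire) e env a : app_mono ->
  (forall e' env' a', R e' env' a' -> R' e' env' a') ->
  step id F app3 R e env a -> step id F app3 R' e env a.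
Proof.
move=> h3 hR; rewrite /step; case: (instr_of e) => //=.
- by move=> d1 d2 [b /hR h /hR]; exists b.
- by move=> d1 d2; case: env => [//|[[|n]|?||| ] env'] //;
    [apply: hR|case=> b /hR h /hR; exists b].
- by move=> d pi [h1 /hR].
- move=> i ds; case: (onth env i) => [it|//].
  case: it ds => [n|g|||] [|d [|d' ds]] //=; try exact: h3.
  + by case=> b /hR; exists b.
  + by case=> j h ->; exists j => // n; apply: hR.
  + by case=> j h ->; exists j => // n; apply: hR.
- by move=> k; case: env => [//|[m|?||| ] env'] // [h /hR].
Qed.

Lemma evI e env a : step id F app3 ev e env a -> ev e env a.
Proof. exact: Ev. Qed.

Lemma evE e env a : app_mono -> ev e env a -> step id F app3 ev e env a.
Proof. by move=> h [R hR]; apply: step_mono. Qed.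

End Ev.

Definition reals_in (N : baire -> Prop) (env : seq (item baire)) : Prop :=
  forall i, if nth (ANum 0) env i is AFun g then N g else True.

Lemma reals_in_Num N n env : reals_in N env -> reals_in N (ANum n :: env).
Proof. by move=> h [|i] //=; apply: h. Qed.

Lemma reals_in_Fun (N : baire -> Prop) g env : N g -> reals_in N env ->
    reals_in N (AFun g :: env).
Proof. by move=> hg h [|i] //=; apply: h. Qed.

Lemma reals_in_behead N t env : reals_in N (t :: env) -> reals_in N env.
Proof. by move=> h i; have := h i.+1. Qed.

Lemma reals_in_perm N pi env : reals_in N env ->
    reals_in N [seq nth (ANum 0) env i | i <- pi].
Proof.
move=> h i; case: (ltnP i (size pi)) => hi; first by rewrite (nth_map 0) //; apply: h.
by rewrite nth_default // size_map.
Qed.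

Lemma reals_in_take N k env : reals_in N env -> reals_in N (take k env).
Proof.
move=> h i; case: (ltnP i k) => hi; first by rewrite nth_take //; apply: h.
by rewrite nth_default // size_take_min; apply: leq_trans hi; apply: geq_minl.
Qed.

(** Two evaluations agree when every function fed to the type-2 arguments lies
    in a set N on which these arguments agree. With N everything this is
    determinism; with N countable it transfers a computation from one type-2
    argument to another. *)
Lemma ev_agree (N : baire -> Prop) F F' X X' :
  app_mono X' ->
  (forall g, N g -> F g = F' g) ->
  (forall d env g, reals_in N env -> (forall n, ev F X d (ANum n :: env) (g n)) ->
     N g) ->
  (forall (R R' : callrel baire) ds env a b, reals_in N env ->
     (forall e env a, R e env a -> ev F X e env a) ->
     (forall e env a b, reals_in N env -> R e env a -> R' e env b -> a = b) ->
     X R ds env a -> X' R' ds env b -> a = b) ->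
  forall e env a, ev F X e env a ->
  forall b, reals_in N env -> ev F' X' e env b -> a = b.
Proof.
move=> mX hF hN hX e env a; elim=> {}e {}env {}a R hR ih st b oe /(evE mX).
move: st; rewrite /step; case: (instr_of e) => //=.
- by case: env oe => [//|[]] // n env' _ -> ->.
- by move=> q -> ->.
- by case: env oe => [//|[]] // n env' _ -> ->.
- move=> d1 d2 [c h2 h1] [c' h2' h1'].
  have hc : c = c' by exact: ih h2 _ oe h2'.
  by subst c'; apply: ih h1 _ _ h1'; apply: reals_in_Num.
- move=> d1 d2; case: env oe => [//|[[|n]|?||| ] env'] // /reals_in_behead oe.
    by move=> h h'; apply: ih h _ oe h'.
  move=> [c h2 h1] [c' h2' h1'].
  have hc : c = c' by apply: ih h2 _ _ h2'; apply: reals_in_Num.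
  by subst c'; apply: ih h1 _ _ h1'; do 2!apply: reals_in_Num.
- by move=> d pi [_ h] [_ h']; apply: ih h _ _ h'; apply: reals_in_perm.
- move=> i ds; case E: (onth env i) => [it|//].
  case: it ds {E} => [n|g|||] [|d [|d' ds]] //=.
  + move=> [c h ->] [c' h' ->].
    by rewrite (ih _ _ _ h _ oe h').
  + move=> [j h ->] [j' h' ->].
    have Nj : N j by apply: (hN d env) => // n; apply: hR.
    suff -> : j' = j by apply: hF.
    by apply: funext => n; apply/esym; apply: ih (h n) _ _ (h' n); apply: reals_in_Num.
  + move=> [j h ->] [j' h' ->].
    suff -> : j' = j by [].
    by apply: funext => n; apply/esym; apply: ih (h n) _ _ (h' n); apply: reals_in_Num.
  + by apply: hX => // e0 env0 a0 b0 o0 r0 r0'; apply: ih r0 _ o0 r0'.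
  + by apply: hX => // e0 env0 a0 b0 o0 r0 r0'; apply: ih r0 _ o0 r0'.
  + by apply: hX => // e0 env0 a0 b0 o0 r0 r0'; apply: ih r0 _ o0 r0'.
- move=> k; case: env oe => [//|[m|?||| ] env'] // /reals_in_behead oe [_ h] [_ h'].
  by apply: ih h _ _ h'; apply: reals_in_take.
Qed.

Notation omega_oracle := (omega_app id).
Notation evo F := (ev F omega_oracle).

Lemma omega_mono : app_mono omega_oracle.
Proof.
move=> R R' ds env a hR; case: ds => [|d1 [|d2 [|? ?]]] //= [n /hR hn h].
exists n => //; case: h => [[j0 /hR h0 [h ->]]|[h ->]]; [left|right].
  by exists j0 => //; split=> // j; case: (h j) => [/hR|]; [left|right].
by split=> // j; apply: hR.
Qed.

Lemma ev_fun F e env a b : evo F e env a -> evo F e env b -> a = b.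
Proof.
move=> h1 h2.
apply: (@ev_agree (fun=> True) F F omega_oracle omega_oracle) h1 b _ h2 => //;
    last first.
- by move=> i; case: nth.
- move=> R R' [|d1 [|d2 [|? ?]]] //= env0 a0 b0 o0 hR hRR [n hn h] [n' hn' h'].
  have o j : reals_in (fun=> True) (AFun j :: env0) by apply: reals_in_Fun.
  have := hRR _ _ _ _ o0 hn hn' => ?; subst n'.
  case: h => [[j0 h0 [h ->]]|[h ->]]; case: h' => [[j0' h0' [h' ->]]|[h' ->]] //.
  + case: (h j0') => [r|-> //].
    by have := hRR _ _ _ _ (o _) r h0'.
  + by have := hRR _ _ _ _ (o _) h0 (h' j0).
  + by have := hRR _ _ _ _ (o _) (h j0') h0'.
- exact: omega_mono.
Qed.

(** * From Kleene's relation to evaluation *)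

Lemma oracle_inj s (p q : Par s) : oracle s p = oracle s q -> p = q.
Proof.
move=> E; have := projT2_eq E.
by rewrite (Prop_irrelevance (projT1_eq E) erefl).
Qed.

Definition interp (F : baire -> nat) (o3 : arg) (t : item baire) : arg :=
  match t with
  | ANum n => num n
  | AFun g => oracle (pure 1) (@tot (pure 1) g)
  | ATwo => oracle (pure 2) (@tot (pure 2) F)
  | AE2 => oracle (pure 2) E2
  | AThree => o3
  end.

Section KleeneEv.
Variables (F : baire -> nat) (o3 : arg).
Variable (X : callrel baire -> seq nat -> seq (item baire) -> nat -> Prop).
Local Notation itp := (map (interp F o3)).

Hypothesis o3_fun : forall n, o3 <> num n.
Hypothesis hX : forall s t (p : Par (s ⇒ t)) (x : Inputs (s ⇒ t)) ds env a,
  o3 = oracle (s ⇒ t) p -> size ds = size (inputs x) ->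
  (forall j d r (g : Tot r), onth ds j = Some d ->
     onth (inputs x) j = Some (existT Tot r g) ->
     forall (xi : Inputs r) env', args xi ++ itp env = itp env' ->
       ev F X d env' (tapp g xi)) ->
  papp p x = Some a -> X (ev F X) ds env a.

Lemma interp_num n t : num n = interp F o3 t -> t = ANum n.
Proof.
case: t => [m|?|||]; rewrite /interp.
- by move=> /oracle_inj [->].
- by move=> /(congr1 (@projT1 _ _)).
- by move=> /(congr1 (@projT1 _ _)).
- by move=> /(congr1 (@projT1 _ _)).
- by move=> /esym /o3_fun.
Qed.

(** The application scheme is the only one that depends on the functional of
    type 3, hence the hypothesis hX. *)
Lemma kleene_ev e phis a : kleene e phis a ->
  forall env, phis = itp env -> ev F X e env a.
Proof.
elim=> {e phis a}.
- move=> n phis [//|t env] [/interp_num -> _].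
  by apply: evI; rewrite /step /instr_of CodeSeq.codeK.
- by move=> q phis env _; apply: evI; rewrite /step /instr_of CodeSeq.codeK.
- move=> n phis [//|t env] [/interp_num -> _].
  by apply: evI; rewrite /step /instr_of CodeSeq.codeK.
- move=> d1 d2 phis b a _ ih2 _ ih1 env E.
  apply: evI; rewrite /step /instr_of CodeSeq.codeK; exists b; first exact: ih2.
  by apply: ih1; rewrite E.
- move=> d1 d2 phis a _ ih [//|t env] [/interp_num -> E].
  by apply: evI; rewrite /step /instr_of CodeSeq.codeK; apply: ih.
- move=> d1 d2 n phis b a _ ih1 _ ih2 [//|t env] [/interp_num -> E].
  apply: evI; rewrite /step /instr_of CodeSeq.codeK; exists b.
    by apply: ih1; rewrite E.
  by apply: ih2; rewrite E.
- move=> d pi phis a hpi _ ih env E.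
  apply: evI; rewrite /step /instr_of CodeSeq.codeK; split.
    by move: hpi; rewrite E size_map.
  apply: ih; rewrite -map_comp; apply/eq_in_map => i.
  rewrite (perm_mem hpi) mem_iota add0n E size_map /= => hi.
  by rewrite -[num 0]/(interp F o3 (ANum 0)) (nth_map (ANum 0)).
- move=> i ds s t p x phis a hi hs _ ih hp env E.
  apply: evI; rewrite /step /instr_of CodeSeq.codeK.
  move: hi; rewrite E onth_map; case: (onth env i) => [it|//] /= [hi].
  have {}ih j d r (g : Tot r) : onth ds j = Some d ->
     onth (inputs x) j = Some (existT Tot r g) ->
     forall (xi : Inputs r) env', args xi ++ itp env = itp env' ->
       ev F X d env' (tapp g xi).
    by move=> h1 h2 xi env' E'; apply: (ih _ _ _ _ h1 h2 xi); rewrite E.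
  case: it hi => [n|g|||] /= hi.
  + by have := congr1 (@projT1 _ _) hi.
  + have := congr1 (@projT1 _ _) hi => /= -[? ?]; subst s t.
    have ? := oracle_inj hi; subst p; case: x hs hp ih => n [] /=.
    case: ds => [|d [|? ?]] //= _ [<-] ih; exists n => //.
    by apply: (ih 0 d TN n erefl erefl tt).
  + have := congr1 (@projT1 _ _) hi => /= -[? ?]; subst s t.
    have ? := oracle_inj hi; subst p; case: x hs hp ih => g [] /=.
    case: ds => [|d [|? ?]] //= _ [<-] ih; exists g => // n.
    by apply: (ih 0 d (pure 1) g erefl erefl (n, tt)).
  + have := congr1 (@projT1 _ _) hi => /= -[? ?]; subst s t.
    have ? := oracle_inj hi; subst p; case: x hs hp ih => g [] /=.
    case: ds => [|d [|? ?]] //= _ [<-] ih; exists g => // n.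
    by apply: (ih 0 d (pure 1) g erefl erefl (n, tt)).
  + by have := hX hi hs ih hp; case: (ds) => [|? [|? ?]].
- move=> m phis psis a _ ih [//|t env] [/interp_num -> E].
  apply: evI; rewrite /step /instr_of CodeSeq.codeK.
  have := congr1 size E; rewrite size_cat size_map => <-; split.
    exact: leq_addr.
  by apply: ih; rewrite map_take -E take_size_cat.
Qed.

End KleeneEv.

Definition phi_app (P : (baire -> nat) -> nat) (R : callrel baire) (ds : seq nat)
    (env : seq (item baire)) (a : nat) : Prop :=
  if ds is [:: d] then
    exists2 G, (forall g, R d (AFun g :: env) (G g)) & a = P G
  else False.

Lemma phi_mono P : app_mono (phi_app P).
Proof.
move=> R R' [|d [|? ?]] env a hR //= [G h ->]; exists G => // g; exact: hR.
Qed.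

Lemma kleene_phi (P : (baire -> nat) -> nat) F e env a :
  let o3 := oracle (pure 3) (fun G => Some (P G)) in
  kleene e (map (interp F o3) env) a -> ev F (phi_app P) e env a.
Proof.
move=> o3 h; apply: (@kleene_ev F o3 (phi_app P)) h env erefl.
  by move=> n /(congr1 (@projT1 _ _)).
move=> s t p x ds env' b /= E.
have := congr1 (@projT1 _ _) E => /= -[? ?]; subst s t.
rewrite -(oracle_inj E) {p E}; case: x => G [] /=.
case: ds => [|d [|? ?]] //= _ ih [<-]; exists G => // g.
by apply: (ih 0 d (pure 2) G erefl erefl (g, tt)).
Qed.

Lemma elements1 (X : baire -> nat) g : (forall f, X f = 1 <-> f = g) ->
  elements X = [:: g].
Proof.
rewrite /elements => h; case: pselect => [ex|[]]; last by exists g; apply/h.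
by case: (cid ex) => f Xf /=; rewrite ((h f).1 Xf).
Qed.

Lemma elements0 (X : baire -> nat) : (forall f, X f <> 1) ->
  elements X = [::].
Proof.
rewrite /elements => h; case: pselect => // ex.
by exfalso; case: ex => f; apply: h.
Qed.

Lemma kleene_omega F e env a :
  let o3 := oracle (pure 2 ⇒ TN ⇒ TN) Omega in
  kleene e (map (interp F o3) env) a -> evo F e env a.
Proof.
move=> o3 h; apply: (@kleene_ev F o3 omega_oracle) h env erefl.
  by move=> n /(congr1 (@projT1 _ _)).
move=> s t p x ds env' b /= E.
have := congr1 (@projT1 _ _) E => /= -[? ?]; subst s t.
rewrite -(oracle_inj E) {p E}; case: x => G [n []] /=.
case: ds => [|d1 [|d2 [|? ?]]] //= _ ih.
rewrite /Omega; case: asboolP => // -[hset h1] [<-].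
have e1 g : evo F d1 (AFun g :: env') (G g).
  by apply: (ih 0 d1 (pure 2) G erefl erefl (g, tt)).
exists n; first by apply: (ih 1 d2 TN n erefl erefl tt).
case: (pselect (exists f, G f = 1)) => [[f Gf]|nG].
  left; exists f; first by rewrite -Gf.
  have hG g : G g = 1 <-> g = f by split=> [Gg|->//]; apply: h1.
  rewrite (elements1 hG); split=> // g.
  by case: (hset g) => hg; [left; rewrite -hg|right; apply/hG].
right; rewrite elements0 => [|f Gf]; last by apply: nG; exists f.
split=> // g; case: (hset g) => hg; first by rewrite -hg.
by case: nG; exists g.
Qed.

(** * Analytic sets of Baire space *)

Definition agree (n : nat) (a b : baire) : Prop := forall k, k < n -> a k = b k.

Lemma agree_leq m n a b : m <= n -> agree n a b -> agree m a b.
Proof. by move=> mn h k km; apply: h; apply: leq_trans mn. Qed.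

(** Continuity into a discrete space. *)
Definition cont T (f : baire -> T) : Prop :=
  forall a, exists n, forall b, agree n a b -> f b = f a.

Definition contR (f : baire -> baire) : Prop := forall k, cont (fun a => f a k).

Lemma cont_cst T (x : T) : cont (fun=> x).
Proof. by move=> a; exists 0. Qed.

Lemma cont_read k : cont (fun a => a k).
Proof. by move=> a; exists k.+1 => b h; rewrite h. Qed.

(** Reading at a position that itself depends on the argument is covered by
    taking f to be the evaluation map. *)
Lemma cont_app T U (f : baire -> T -> U) (g : baire -> T) :
  (forall x, cont (f^~ x)) -> cont g -> cont (fun a => f a (g a)).
Proof.
move=> hf hg a; have [n hn] := hg a; have [m hm] := hf (g a) a.
exists (maxn m n) => b h; rewrite hn ?hm //; apply: agree_leq h.
  exact: leq_maxl.
exact: leq_maxr.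
Qed.

Lemma cont_map T U (f : T -> U) (g : baire -> T) :
  cont g -> cont (fun a => f (g a)).
Proof. by move=> hg; apply: (@cont_app _ _ (fun=> f)) hg => x; apply: cont_cst. Qed.

Lemma contR_agree f : contR f ->
  forall a n, exists m, forall b, agree m a b -> agree n (f a) (f b).
Proof.
move=> hf a; elim=> [|n [m hm]]; first by exists 0.
have [k hk] := hf n a; exists (maxn m k) => b h i.
rewrite ltnS leq_eqVlt => /orP[/eqP ->|].
  by rewrite hk //; apply: agree_leq h; apply: leq_maxr.
by apply: hm; apply: agree_leq h; apply: leq_maxl.
Qed.

Lemma cont_comp T (g : baire -> T) f : cont g -> contR f -> cont (fun a => g (f a)).
Proof.
move=> hg hf a; have [n hn] := hg (f a); have [m hm] := contR_agree hf a n.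
by exists m => b /hm h; apply: hn.
Qed.

Lemma cont_seq T U (f : baire -> T -> U) (s : seq T) :
  (forall x, cont (f^~ x)) -> cont (fun a => map (f a) s).
Proof.
move=> hf; elim: s => [|x s ih]; first exact: cont_cst.
apply: (@cont_app _ _ (fun a y => y :: map (f a) s)) (hf x) => y.
exact: cont_map ih.
Qed.

Lemma cont_mkseq f n : contR f -> cont (fun a => mkseq (f a) n).
Proof. by move=> hf; apply: cont_seq. Qed.

Lemma contR_id : contR id.
Proof. exact: cont_read. Qed.

Lemma contR_cst b : contR (fun=> b).
Proof. by move=> k; apply: cont_cst. Qed.

Lemma contR_comp f g : contR f -> contR g -> contR (fun a => f (g a)).
Proof. by move=> hf hg k; apply: (cont_comp (hf k) hg). Qed.

(** Closedness as a subset of the product of two copies of Baire space. *)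
Definition closed_rel (D : baire -> baire -> Prop) : Prop := forall a w,
  (forall n, exists a' w', [/\ agree n a a', agree n w w' & D a' w']) -> D a w.

Definition analytic (P : baire -> Prop) : Prop :=
  exists2 D, closed_rel D & forall a, P a <-> exists w, D a w.

Lemma eq_analytic P Q : (forall a, P a <-> Q a) -> analytic P -> analytic Q.
Proof. by move=> h [D cD hD]; exists D => // a; rewrite -h. Qed.

Lemma analytic_cont (f : baire -> bool) : cont f -> analytic f.
Proof.
move=> hf; exists (fun a _ => f a).
  move=> a w H; have [n hn] := hf a; have [a' [w' [h _]]] := H n.
  by rewrite hn.
by move=> a; split=> [h|[]//]; exists a.
Qed.

(** One witness codes countably many: column i of w witnesses P i. *)
Lemma analytic_all (I : countType) (P : I -> baire -> Prop) :
  (forall i, analytic (P i)) -> analytic (fun a => forall i, P i a).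
Proof.
move=> hP; have /choice [D hD] : forall i, exists D,
    closed_rel D /\ forall a, P i a <-> exists w, D a w.
  by move=> i; have [D h1 h2] := hP i; exists D.
exists (fun a w => forall i, D i a (fun k => w (pickle (i, k)))).
  move=> a w H i; apply: (hD i).1 => n.
  pose m := \max_(k < n) (pickle (i, k : nat)).+1.
  have [a' [w' [h1 h2 h3]]] := H (maxn n m).
  exists a', (fun k => w' (pickle (i, k))); split=> //.
    by apply: agree_leq h1; apply: leq_maxl.
  move=> k kn; apply: h2; apply: leq_trans (leq_maxr _ _).
  exact: (@leq_bigmax _ (fun k : 'I_n => (pickle (i, k : nat)).+1) (Ordinal kn)).
move=> a; split=> [h|[w h] i]; last by apply/(hD i).2;
    exists (fun k => w (pickle (i, k))).
have [w hw] := choice (fun i => ((hD i).2 a).1 (h i)).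
exists (fun n => if unpickle n is Some (i, k) then w i k else 0) => i.
rewrite (_ : (fun k => _) = w i) //.
by apply: funext => k; rewrite pickleK.
Qed.

Lemma analytic_ex_nat (P : nat -> baire -> Prop) :
  (forall i, analytic (P i)) -> analytic (fun a => exists i, P i a).
Proof.
move=> hP; have /choice [D hD] : forall i, exists D,
    closed_rel D /\ forall a, P i a <-> exists w, D a w.
  by move=> i; have [D h1 h2] := hP i; exists D.
exists (fun a w => D (w 0) a (fun k => w k.+1)).
  move=> a w H; apply: (hD _).1 => n.
  have [a' [w' [h1 h2 h3]]] := H n.+1.
  exists a', (fun k => w' k.+1); split; last by rewrite h2.
    exact: agree_leq h1.
  by move=> k kn; apply: h2.
move=> a; split=> [[i /(hD i).2 [w hw]]|[w hw]].
  by exists (fun k => if k is k'.+1 then w k' else i).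
by exists (w 0); apply/(hD _).2; exists (fun k => w k.+1).
Qed.

Lemma analytic_false : analytic (fun=> False).
Proof.
by apply: (@eq_analytic (fun=> false)) => //; apply: analytic_cont; apply: cont_cst.
Qed.

Lemma analytic_ex (I : countType) (P : I -> baire -> Prop) :
  (forall i, analytic (P i)) -> analytic (fun a => exists i, P i a).
Proof.
move=> hP.
apply: (@eq_analytic (fun a => exists n,
    if unpickle n is Some i then P i a else False)).
  move=> a; split=> [[n]|[i h]]; last by exists (pickle i); rewrite pickleK.
  by case: unpickle => // i h; exists i.
by apply: analytic_ex_nat => n; case: unpickle => // ; apply: analytic_false.
Qed.

Definition left_half (c : baire) : baire := fun n => c n.*2.
Definition right_half (c : baire) : baire := fun n => c n.*2.+1.
Definition interleave (a b : baire) :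
    baire := fun n => if odd n then b n./2 else a n./2.

Lemma left_half_interleave a b : left_half (interleave a b) = a.
Proof. by apply: funext => n; rewrite /left_half /interleave odd_double doubleK. Qed.

Lemma right_half_interleave a b : right_half (interleave a b) = b.
Proof. by apply: funext => n; rewrite /right_half /interleave /= odd_double
    uphalf_double. Qed.

Lemma contR_left_half : contR left_half.
Proof. by move=> k; apply: cont_read. Qed.

Lemma contR_right_half : contR right_half.
Proof. by move=> k; apply: cont_read. Qed.

Lemma agree_interleave n a a' b b' :
  agree n a a' -> agree n b b' -> agree n (interleave a b) (interleave a' b').
Proof.
move=> ha hb k kn; have h : k./2 < n.
  by apply: leq_ltn_trans kn; rewrite leq_half_double -addnn -addnS leq_addr.
by rewrite /interleave; case: odd; [apply: hb|apply: ha].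
Qed.

Lemma analytic_ex_baire (P : baire -> baire -> Prop) :
  analytic (fun c => P (left_half c) (right_half c)) ->
      analytic (fun a => exists b, P a b).
Proof.
case=> D cD hD; exists (fun a w => D (interleave a (left_half w)) (right_half w)).
  move=> a w H; apply: cD => n; have [a' [w' [h1 h2 h3]]] := H n.*2.+1.
  have nn : n <= n.*2.+1 by rewrite -addnn -addnS leq_addr.
  exists (interleave a' (left_half w')), (right_half w'); split=> //.
    apply: agree_interleave; first exact: agree_leq h1.
    by move=> k kn; apply: h2; rewrite ltnS leq_double ltnW.
  by move=> k kn; apply: h2; rewrite ltnS ltn_double.
move=> a; split=> [[b h]|[w h]].
  have /(hD _).1 [w hw] : P (left_half (interleave a b)) (right_half
      (interleave a b)) by rewrite left_half_interleave right_half_interleave.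
  by exists (interleave b w); rewrite left_half_interleave right_half_interleave.
exists (left_half w); have : P (left_half (interleave a (left_half w))) (right_half
    (interleave a (left_half w))).
  by apply/(hD _).2; exists (right_half w).
by rewrite left_half_interleave right_half_interleave.
Qed.

Lemma analytic_closed D f g : closed_rel D -> contR f -> contR g ->
  analytic (fun a => D (f a) (g a)).
Proof.
move=> cD hf hg; exists (fun a _ => D (f a) (g a)).
  move=> a w H; apply: cD => n.
  have [m hm] := contR_agree hf a n; have [m' hm'] := contR_agree hg a n.
  have [a' [w' [h1 h2 h3]]] := H (maxn m m').
  exists (f a'), (g a'); split=> //; [apply: hm|apply: hm'].
    by apply: agree_leq h1; apply: leq_maxl.
  by apply: agree_leq h1; apply: leq_maxr.
by move=> a; split=> [h|[]//]; exists a.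
Qed.

(** The Borel sets, by Suslin's theorem; only the evident closure under
    complements and countable operations is used. *)
Definition bianalytic (P : baire ->
    Prop) : Prop := analytic P /\ analytic (fun a => ~ P a).

Lemma eq_bianalytic P Q : (forall a, P a <-> Q a) -> bianalytic P -> bianalytic Q.
Proof.
move=> h [h1 h2]; split; first exact: eq_analytic h1.
by apply: eq_analytic h2 => a; rewrite h.
Qed.

Lemma bianalytic_cont T (Q : T -> Prop) (f : baire -> T) : cont f ->
    bianalytic (fun a => Q (f a)).
Proof.
move=> hf; split.
  apply: (@eq_analytic (fun a => `[< Q (f a) >])); first by move=> a; split=> /asboolP.
  by apply: analytic_cont; apply: (@cont_map _ _ (fun x => `[< Q x >])).
apply: (@eq_analytic (fun a => `[< ~ Q (f a) >])); first by move=> a; split=> /asboolP.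
by apply: analytic_cont; apply: (@cont_map _ _ (fun x => `[< ~ Q x >])).
Qed.

Lemma bianalytic_cst (P : Prop) : bianalytic (fun=> P).
Proof. exact: (@bianalytic_cont Prop id _ (cont_cst P)). Qed.

Lemma bianalytic_not P : bianalytic P -> bianalytic (fun a => ~ P a).
Proof.
move=> [h1 h2]; split=> //; apply: eq_analytic h1 => a.
by split=> [h /(_ h)|/contrapT].
Qed.

Lemma bianalytic_all (I : countType) (P : I -> baire -> Prop) :
  (forall i, bianalytic (P i)) -> bianalytic (fun a => forall i, P i a).
Proof.
move=> h; split; first by apply: analytic_all => i; case: (h i).
apply: (@eq_analytic (fun a => exists i, ~ P i a)).
  by move=> a; split=> [[i hi] /(_ i)|/existsNP].
by apply: analytic_ex => i; case: (h i).
Qed.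

Lemma bianalytic_ex (I : countType) (P : I -> baire -> Prop) :
  (forall i, bianalytic (P i)) -> bianalytic (fun a => exists i, P i a).
Proof.
move=> h; split; first by apply: analytic_ex => i; case: (h i).
apply: (@eq_analytic (fun a => forall i, ~ P i a)).
  by move=> a; split=> [hi [i]|hn i hi]; [apply: hi|apply: hn; exists i].
by apply: analytic_all => i; case: (h i).
Qed.

Lemma bianalytic_and P Q : bianalytic P -> bianalytic Q ->
    bianalytic (fun a => P a /\ Q a).
Proof.
move=> hP hQ; apply: (@eq_bianalytic (fun a => forall b : bool,
    if b then P a else Q a)).
  by move=> a; split=> [h|[h1 h2] []//]; split; [apply: (h true)|apply: (h false)].
by apply: bianalytic_all => -[].
Qed.

Lemma bianalytic_or P Q : bianalytic P -> bianalytic Q ->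
    bianalytic (fun a => P a \/ Q a).
Proof.
move=> hP hQ; apply: (@eq_bianalytic (fun a => exists b : bool,
    if b then P a else Q a)).
  move=> a; split=> [[[] h]|[]h]; [by left|by right|by exists true|by exists false].
by apply: bianalytic_ex => -[].
Qed.

Lemma bianalytic_imp P Q : bianalytic P -> bianalytic Q ->
    bianalytic (fun a => P a -> Q a).
Proof.
move=> hP hQ; apply: (@eq_bianalytic (fun a => ~ P a \/ Q a)).
  by move=> a; split=> [[h /h|]//|h]; case: (pselect (P a)) => [/h|]; [right|left].
by apply: bianalytic_or => //; apply: bianalytic_not.
Qed.

Lemma bianalytic_iff P Q : bianalytic P -> bianalytic Q ->
    bianalytic (fun a => P a <-> Q a).
Proof. by move=> hP hQ; apply: bianalytic_and; apply: bianalytic_imp. Qed.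

Lemma bianalytic_ex2 (I : countType) (P Q : I -> baire -> Prop) :
  (forall i, bianalytic (P i)) -> (forall i, bianalytic (Q i)) ->
  bianalytic (fun a => exists2 i, P i a & Q i a).
Proof.
move=> hP hQ; apply: (@eq_bianalytic (fun a => exists i, P i a /\ Q i a)).
  by move=> a; split=> [[i []]|[i]]; exists i.
by apply: bianalytic_ex => i; apply: bianalytic_and.
Qed.

Lemma bianalytic_eqR f g : contR f -> contR g -> bianalytic (fun a => f a = g a).
Proof.
move=> hf hg; apply: (@eq_bianalytic (fun a => forall k : nat, f a k = g a k)).
  by move=> a; split=> [/funext|->].
apply: bianalytic_all => k; apply: (@bianalytic_cont _ (fun x => x.1 =
    x.2) (fun a => (f a k, g a k))).
by apply: (@cont_app _ _ (fun a y => (f a k, y))) => // y;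
    apply: (@cont_map _ _ (fun x => (x, y))).
Qed.

(** * Comparing the ranks of trees *)

Section Trees.
Variable T : baire -> seq nat -> bool.
Hypothesis T_rcons : forall v t a, T v (rcons t a) -> T v t.

Definition child v (t1 t2 : seq nat) : Prop :=
  exists2 a, t1 = rcons t2 a & T v t1.

Definition wellfounded v t := Acc (child v) t.

Lemma path_not_wellfounded v w : (forall n, T v (mkseq w n)) -> ~ wellfounded v [::].
Proof.
move=> h; suff H t : wellfounded v t -> forall n, t <> mkseq w n by move=> /H /(_ 0).
elim=> {}t _ ih {}n e; apply: (ih (mkseq w n.+1) _ n.+1 erefl).
by exists (w n) => //; rewrite e mkseqS.
Qed.

Lemma not_wellfounded_path v : ~ wellfounded v [::] ->
    exists w, forall n, T v (mkseq w n).
Proof.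
move=> nw; have /choice [nx hnx] : forall t, exists a,
    ~ wellfounded v t -> T v (rcons t a) /\ ~ wellfounded v (rcons t a).
  move=> t; case: (pselect (wellfounded v t)) => [h|nh]; first by exists 0.
  apply: contrapT => /forallNP H; apply: nh; split=> _ [a -> Ta].
  by apply: contrapT => nwa; apply: (H a).
pose s := fix s n := if n is n'.+1 then rcons (s n') (nx (s n')) else [::].
have hs n : ~ wellfounded v (s n).
  by elim: n => [//|n ih]; case: (hnx _ ih).
exists (nx \o s) => n.
suff -> : mkseq (nx \o s) n = s n.
  by apply: (@T_rcons _ _ (nx (s n))); case: (hnx _ (hs n)).
by elim: n => [//|n ih]; rewrite mkseqS ih.
Qed.

(** The rank of one node is at most that of another, where the rank of a node
    on an infinite branch is infinity. As a greatest fixed point, a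
    simulation, it needs no ordinals. *)
Definition rank_le (x y : baire * seq nat) : Prop :=
  exists2 R : seq nat -> seq nat -> Prop,
    forall t t', R t t' -> forall a, T x.1 (rcons t a) ->
      exists2 a', T y.1 (rcons t' a') & R (rcons t a) (rcons t' a')
  & R x.2 y.2.

Lemma rank_leE v t v' t' : rank_le (v, t) (v', t') <->
  forall a, T v (rcons t a) -> exists2 a', T v' (rcons t' a') &
    rank_le (v, rcons t a) (v', rcons t' a').
Proof.
split=> [[R hR /= r] a Ta|h].
  by have [a' Ta' ra'] := hR _ _ r a Ta; exists a' => //; exists R.
exists (fun s s' => rank_le (v, s) (v', s') \/ s = t /\ s' = t'); last by right.
move=> s s' hs a Ta.
have {Ta} [a' Ta' h'] : exists2 a', T v' (rcons s' a') &
    rank_le (v, rcons s a) (v', rcons s' a').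
  case: hs => [[R hR /= r]|[? ?]]; last by subst; apply: h.
  by have [a' Ta' ra'] := hR _ _ r a Ta; exists a' => //; exists R.
by exists a' => //; left.
Qed.

Definition rank_lt y x := ~ rank_le x y.

(** If t' has smaller rank than t, then all children of t' have smaller rank
    than one fixed child of t; the induction hypothesis for that child gives
    accessibility of t'. *)
Lemma wellfounded_acc v t : wellfounded v t -> Acc rank_lt (v, t).
Proof.
elim=> {}t _ ih; split=> -[v' t'] /rank_leE /existsNP [a] /not_implyP [Ta h].
have {}ih := ih _ (ex_intro2 _ _ a erefl Ta).
have {}h a' : T v' (rcons t' a') -> rank_lt (v', rcons t' a') (v, rcons t a).
  by move=> Ta' h'; apply: h; exists a'.
move: ih h; move: (v, rcons t a) => z az {v t a Ta}.
elim: az v' t' => {}z _ ih v' t' h; split=> -[v'' t''].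
move=> /rank_leE /existsNP [a] /not_implyP [Ta h'].
apply: ih (h _ Ta) _ _ _ => a'' Ta'' h''; apply: h'; by exists a''.
Qed.

Lemma rank_le_not_wellfounded v t v' t' : ~ wellfounded v' t' ->
    rank_le (v, t) (v', t').
Proof.
move=> nw; exists (fun _ s => ~ wellfounded v' s) => // _ s hs _ _ {nw}.
apply: contrapT => H; apply: hs; split=> _ [a -> Ta].
by apply: contrapT => nwa; apply: H; exists a.
Qed.

(** Ranks are wellordered. *)
Lemma rank_min (S : baire -> Prop) : (exists v, S v) ->
  exists2 v, S v & forall v', S v' -> rank_le (v, [::]) (v', [::]).
Proof.
move=> [v0 Sv0]; case: (pselect (exists2 v, S v & wellfounded v [::])); last first.
  by move=> H; exists v0 => // v' Sv'; apply: rank_le_not_wellfounded => w; apply: H;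
      exists v'.
move=> [v Sv /wellfounded_acc A];
    have [x E] : exists x, x = (v, [::] : seq nat) by eexists.
rewrite -E in A; elim: A v Sv E => {}x _ ih v Sv E.
case: (pselect (forall v', S v' -> rank_le (v, [::]) (v', [::]))).
  by exists v.
move=> /existsNP [v' /not_implyP [Sv' h]].
by apply: (ih (v', [::])) Sv' erefl; rewrite E.
Qed.

Definition table_says (r : baire) (t t' : seq nat) : Prop := r (pickle (t, t')) = 1.

(** The table r satisfies the recursive equation of rank_le at all pairs of
    nodes. This is arithmetical in r, whereas being the true rank comparison
    is not: between two nodes with infinite branches the table may say
    anything. *)
Definition comparison v v' (r : baire) : Prop := forall t t',
  table_says r t t' <-> forall a, T v (rcons t a) ->
    exists2 a', T v' (rcons t' a') & table_says r (rcons t a) (rcons t' a').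

(** The recursive equation determines the table as soon as one of the two nodes
    is wellfounded. Hence a table can be trusted to transfer wellfoundedness,
    although a countable structure cannot recognize wellfoundedness. *)
Lemma comparison_le v v' r t t' : comparison v v' r ->
  table_says r t t' -> wellfounded v' t' -> wellfounded v t.
Proof.
move=> C + w; elim: w t => {}t' _ ih t /C h; split=> _ [a -> Ta].
by have [a' Ta' r'] := h _ Ta; apply: ih r'; exists a'.
Qed.

Lemma comparison_gt v v' r t t' : comparison v v' r ->
  ~ table_says r t t' -> wellfounded v t -> wellfounded v' t'.
Proof.
move=> C + w; elim: w t' => {}t _ ih t' /C /existsNP [a] /not_implyP [Ta h].
split=> _ [a' -> Ta']; apply: (ih (rcons t a)); first by exists a.
by move=> r'; apply: h; exists a'.
Qed.

Lemma comparison_ex v v' : exists r, comparison v v' r /\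
  (forall t t', table_says r t t' <-> rank_le (v, t) (v', t')).
Proof.
pose r n := if unpickle n is Some (t, t') then
  `[< rank_le (v, t) (v', t') >] : nat else 0.
have hr t t' : table_says r t t' <-> rank_le (v, t) (v', t').
  by rewrite /table_says /r pickleK; case: asboolP.
exists r; split=> // t t'; split=> [/hr/rank_leE h a /h [a' Ta' /hr]|h].
  by exists a'.
by apply/hr/rank_leE => a /h [a' Ta' /hr]; exists a'.
Qed.

End Trees.

(** * Good structures *)

(** A real codes a doubly indexed family of reals, in blocks t. *)
Definition component (x : baire) (t i : nat) : baire := fun n => x (pickle (t, i, n)).

Definition assemble (f : nat -> nat -> baire) : baire := fun n =>
  if (unpickle n : option (nat * nat * nat)) is Some (t, i, k) then f t i k
  else 0.

Lemma component_assemble f t i : component (assemble f) t i = f t i.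
Proof. by apply: funext => n; rewrite /component /assemble pickleK. Qed.

Lemma contR_component f t i : contR f -> contR (fun a => component (f a) t i).
Proof. by move=> hf k; apply: hf. Qed.

Lemma contR_assemble (f : baire -> nat -> nat -> baire) :
  (forall t i, contR (fun a => f a t i)) -> contR (fun a => assemble (f a)).
Proof.
move=> h k; rewrite /assemble; case: unpickle => [[[t i] n]|]; first exact: h.
exact: cont_cst.
Qed.

(** A real read as a countable structure: an enumerated set of reals, the values
    of a type-2 function at them, and a set of asserted evaluations. *)
Definition member (x : baire) (i : nat) : baire := component x 0 i.
Definition member_value (x : baire) (i : nat) : nat := component x 1 i 0.
Definition claims (x : baire) : callrel nat :=
  fun e env a => component x 2 (pickle (e, env, a)) 0 = 1.

(** A query asks for a structure that extends the listed reals L and refutes a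
    computation coded by kappa. Z is a table coding the trees of all problems;
    it is an explicit component because good structures talk about these trees
    while the trees search for good structures. *)
Definition query (Z : baire) (kappa : nat) (L : seq baire) :
    baire := assemble (fun t i =>
  match t with
  | 0 => Z
  | 1 => fun=> if i is 0 then kappa else size L
  | _ => nth (fun=> 0) L i
  end).
Definition query_table (u : baire) : baire := component u 0 0.
Definition query_goal (u : baire) : nat := component u 1 0 0.
Definition query_size (u : baire) : nat := component u 1 1 0.
Definition query_member (u : baire) (k : nat) : baire := component u 2 k.

(** A problem asks for an answer to the query u that begins with the digits s and
    respects the values bv at the points bm. *)
Definition problem (u : baire) (bm : nat -> baire) (bv : nat ->
    nat) (s : seq nat) : baire :=
  assemble (fun t i =>
  match t with
  | 0 => u
  | 1 => bm i
  | 2 => fun=> bv i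
  | _ => fun=> pickle s
  end).
Definition problem_query (v : baire) : baire := component v 0 0.
Definition problem_member (v : baire) (l : nat) : baire := component v 1 l.
Definition problem_value (v : baire) (l : nat) : nat := component v 2 l 0.
Definition problem_prefix (v : baire) :
    seq nat := odflt [::] (unpickle (component v 3 0 0)).

Lemma query_table_query Z kappa L : query_table (query Z kappa L) = Z.
Proof. by rewrite /query_table component_assemble. Qed.
Lemma query_goal_query Z kappa L : query_goal (query Z kappa L) = kappa.
Proof. by rewrite /query_goal component_assemble. Qed.
Lemma query_size_query Z kappa L : query_size (query Z kappa L) = size L.
Proof. by rewrite /query_size component_assemble. Qed.
Lemma query_member_query Z kappa L k : query_member (query Z kappa L) k =
    nth (fun=> 0) L k.
Proof. by rewrite /query_member component_assemble. Qed.

Lemma problem_query_problem u bm bv s : problem_query (problem u bm bv s) = u.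
Proof. by rewrite /problem_query component_assemble. Qed.
Lemma problem_member_problem u bm bv s l : problem_member (problem u bm bv s) l = bm l.
Proof. by rewrite /problem_member component_assemble. Qed.
Lemma problem_value_problem u bm bv s l : problem_value (problem u bm bv s) l = bv l.
Proof. by rewrite /problem_value component_assemble. Qed.
Lemma problem_prefix_problem u bm bv s : problem_prefix (problem u bm bv s) = s.
Proof. by rewrite /problem_prefix component_assemble pickleK. Qed.

(** The tree of the problem v is read off from the table in its own query. *)
Definition table_tree (v : baire) (t : seq nat) : bool :=
  all (fun k => query_table (problem_query v) (pickle (mkseq v k, take k t)) != 0)
      (iota 0 (size t).+1).

Lemma tree_rcons v t a : table_tree v (rcons t a) -> table_tree v t.
Proof.
move=> /allP h; apply/allP => k; rewrite mem_iota add0n /= ltnS => kt.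
have /h : k \in iota 0 (size (rcons t a)).+1.
  by rewrite mem_iota add0n size_rcons ltnS leqW.
by rewrite -cats1 takel_cat.
Qed.

Definition initial (s : seq nat) (z : baire) : Prop := mkseq z (size s) = s.

(** The place of digit k of member i in an answer; the factor 2 is there because
    the structure is the left half of the answer. *)
Definition digit_pos (i k : nat) : nat := (pickle (0, i, k)).*2.

(** No common extension, as far as member i of the structure is concerned. *)
Definition incompat i (s s' : seq nat) : Prop := exists k,
  [/\ digit_pos i k < size s, digit_pos i k < size s' &
      nth 0 s (digit_pos i k) <> nth 0 s' (digit_pos i k)].

(** The part of b reserved for the prefix s. *)
Definition part T (b : nat -> T) (s : seq nat) (l : nat) : T := b (pickle (s, l)).
Definition scons T (x : T) (b : nat -> T) (l : nat) : T :=
  if l is l'.+1 then b l' else x.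

Section Saturated.
Variables (x u : baire) (bm : nat -> baire) (bv : nat -> nat).

(** The part for s is meant to minimize the rank of the problem with prefix s. *)
Definition part_problem s := problem u (part bm s) (part bv s) s.

(** Problems with a solution have rank infinity. If all answers beyond s0 have the
    same member i, then a prefix that contradicts this member is dominated by
    every sufficiently long prefix of an answer. *)
Definition dominated s0 i s : Prop := exists2 s', prefix s0 s' /\ incompat i s s' &
  exists j, comparison table_tree (part_problem s) (part_problem s') (member x j) /\
      table_says (member x j) [::] [::].

Definition undominated s0 i s : Prop := forall s', prefix s0 s' /\ incompat i s s' ->
  exists j, comparison table_tree (part_problem s) (part_problem s') (member x j) /\
      ~ table_says (member x j) [::] [::].

Definition sat_base : Prop := forall l, exists j, bm l = member x j /\
    bv l = member_value x j.

(** The part for s already minimizes the rank: the whole base and one more point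
    of x do not lower it. Here bm and bv consist of the parts for all
    prefixes. *)
Definition sat_min : Prop := forall s j, exists k,
  comparison table_tree (part_problem s) (problem u (scons (member x j) bm) (scons
      (member_value x j) bv) s) (member x k)
  /\ table_says (member x k) [::] [::].

(** If the answers beyond s0 determine member i uniquely, then x contains it:
    the first alternative is then impossible, and in the second one member x j
    must be this real. *)
Definition sat_lim : Prop := forall s0 i,
  (exists s1 s2, (prefix s0 s1 /\ prefix s0 s2) /\
     (incompat i s1 s2 /\ (undominated s0 i s1 /\ undominated s0 i s2)))
  \/ exists j, forall s, prefix s0 s ->
       dominated s0 i s \/ forall k, digit_pos i k < size s ->
           nth 0 s (digit_pos i k) = member x j k.

End Saturated.

Definition base_member (B : baire) : nat -> baire := component B 0.
Definition base_value (B : baire) (l : nat) : nat := component B 1 l 0.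

Definition consistent x := forall i j, member x i = member x j ->
    member_value x i = member_value x j.

Definition closed_struct x := forall e env a,
  step (member x) (member_value x) (omega_app (member x)) (claims x) e env a ->
      claims x e env a.

(** The base B of a query is a countable set of points with their values; that it
    comes from x makes it compatible with everything that x is compatible
    with. *)
Definition saturated Z x := forall kappa N, exists j,
  let u := query Z kappa (mkseq (member x) N) in
  let bm := base_member (member x j) in let bv := base_value (member x j) in
  sat_base x bm bv /\ (sat_min x u bm bv /\ sat_lim x u bm bv).

Definition good_struct Z x := consistent x /\ (closed_struct x /\ saturated Z x).

Definition shift_env (env : seq (item nat)) := map (item_map S) env.

(** The two kinds of refutation. With b the structure does not claim that
    function number 0 is outside the set computed by d; otherwise it claims no
    values other than those of function number 0 for the function computed by
    d. A value that is not claimed is certified to be wrong, since [forced]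
    values are claimed. *)
Definition meets_goal (kappa : nat) (y : baire) : Prop :=
  forall (b : bool) (d : nat) (env : seq (item nat)), kappa = pickle (b, d, env) ->
  if b then ~ claims y d (AFun 0 :: shift_env env) 0
  else forall n a, claims y d (ANum n :: shift_env env) a -> a = member y 0 n.

(** Member 0 is left free: it is the real that the query is about. *)
Definition extends_query u y := forall k, k < query_size u ->
    member y k.+1 = query_member u k.

Definition answers u y := good_struct (query_table u) y /\ (extends_query u y /\
    meets_goal (query_goal u) y).

Lemma contR_mkseq_nth (f : baire -> nat -> baire) N k :
  (forall i, contR (fun a => f a i)) ->
  contR (fun a => nth (fun=> 0) (mkseq (f a) N) k).
Proof.
move=> hf; case: (ltnP k N) => kN.
  by rewrite (_ : (fun _ => _) = (fun a => f a k)) //; apply: funext => a;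
      rewrite nth_mkseq.
rewrite (_ : (fun _ => _) = (fun _ => (fun=> 0))); first exact: contR_cst.
by apply: funext => a; rewrite nth_default // size_mkseq.
Qed.

Lemma contR_query fZ kappa f N : contR fZ -> (forall i, contR (fun a => f a i)) ->
  contR (fun a => query (fZ a) kappa (mkseq (f a) N)).
Proof.
move=> hZ hf; apply: contR_assemble => -[|[|t]] i //.
  by case: i => [|i] k; rewrite ?size_mkseq; [|under eq_fun do rewrite size_mkseq];
      apply: cont_cst.
exact: contR_mkseq_nth.
Qed.

Lemma contR_problem fu fm fv s : contR fu -> (forall l, contR (fun a => fm a l)) ->
  (forall l, cont (fun a => fv a l)) -> contR (fun a => problem (fu a) (fm a) (fv a) s).
Proof.
move=> hu hm hv; apply: contR_assemble => -[|[|[|t]]] i //.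
by move=> k; apply: cont_cst.
Qed.

Lemma cont_tree t : cont (table_tree^~ t).
Proof.
rewrite /table_tree; pose f (v :
    baire) k := query_table (problem_query v) (pickle (mkseq v k, take k t)) != 0.
have -> : (fun v => all (f v) (iota 0 (size t).+1)) =
          (fun v => all id (map (f v) (iota 0 (size t).+1))).
  by apply: funext => v; rewrite all_map.
apply: (@cont_map _ _ (all id)); apply: cont_seq => k.
apply: (@cont_map _ _ (fun n => n != 0)); apply: cont_app => [n|].
  exact: cont_read.
by apply: (@cont_map _ _ (fun s : seq nat => pickle (0, 0, pickle (s, take k t))));
    apply: cont_mkseq; apply: contR_id.
Qed.

Lemma bianalytic_table_says f t t' : contR f ->
    bianalytic (fun a => table_says (f a) t t').
Proof. by move=> hf; apply: (@bianalytic_cont _ (fun n => n = 1) (fun a => f a _)). Qed.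

Lemma bianalytic_comparison f f' g : contR f -> contR f' -> contR g ->
  bianalytic (fun a => comparison table_tree (f a) (f' a) (g a)).
Proof.
move=> hf hf' hg; do 2!apply: bianalytic_all => ?; apply: bianalytic_iff;
    first exact: bianalytic_table_says.
apply: bianalytic_all => b; apply: bianalytic_imp.
  exact: (@bianalytic_cont _ is_true _ (cont_comp (cont_tree _) hf)).
apply: bianalytic_ex2 => b'; last exact: bianalytic_table_says.
exact: (@bianalytic_cont _ is_true _ (cont_comp (cont_tree _) hf')).
Qed.

Lemma bianalytic_analytic P : bianalytic P -> analytic P.
Proof. by case. Qed.

Section Definable.
Variables (fx fZ : baire -> baire).
Hypotheses (hx : contR fx) (hZ : contR fZ).

Lemma contR_member i : contR (fun a => member (fx a) i).
Proof. exact: contR_component. Qed.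

Lemma cont_value i : cont (fun a => member_value (fx a) i).
Proof. exact: hx. Qed.

Lemma bianalytic_claims e env c : bianalytic (fun a => claims (fx a) e env c).
Proof. by apply: (@bianalytic_cont _ (fun n => n = 1) (fun a => fx a _)). Qed.

Lemma bianalytic_claims_cont e env f : cont f ->
    bianalytic (fun a => claims (fx a) e env (f a)).
Proof.
move=> hf; apply: (@bianalytic_cont _ (fun n => n = 1) (fun a => fx a _)).
apply: cont_app => [n|]; first exact: hx.
exact: (@cont_map _ _ (fun c => pickle (2, pickle (e, env, c), 0))).
Qed.

Lemma bianalytic_eqn (f : baire -> nat) n : cont f -> bianalytic (fun a => n = f a).
Proof. exact: bianalytic_cont. Qed.

Lemma bianalytic_omega ds env c :
    bianalytic (fun a => omega_app (member (fx a)) (claims (fx a)) ds env c).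
Proof.
case: ds => [|d1 [|d2 [|? ?]]]; try exact: bianalytic_cst.
apply: bianalytic_ex2 => n; first exact: bianalytic_claims.
apply: bianalytic_or.
  apply: bianalytic_ex2 => j; first exact: bianalytic_claims.
  apply: bianalytic_and.
    apply: bianalytic_all => k; apply: bianalytic_or; first exact: bianalytic_claims.
    by apply: bianalytic_eqR; apply: contR_member.
  apply: bianalytic_eqn; case: n => [|n]; first exact: cont_cst.
  rewrite (_ : (fun _ => _) = (fun a => member (fx a) j n)); first exact: contR_member.
  by apply: funext => a; rewrite /seqcode /= modn1 divn1.
apply: bianalytic_and; last exact: bianalytic_cst.
by apply: bianalytic_all => k; apply: bianalytic_claims.
Qed.

Lemma bianalytic_E2 c (f : baire -> baire) : contR f ->
    bianalytic (fun a => c = E2fun (f a)).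
Proof.
move=> hf; apply: (@eq_bianalytic (fun a => ((exists n : nat, f a n = 0) -> c = 0) /\
  (~ (exists n : nat, f a n = 0) -> c = 1))).
  move=> a; rewrite /E2fun; case: asboolP => h; split=> [[h1 h2]|->].
  - exact: h1.
  - by split.
  - exact: h2.
  - by split.
have h : bianalytic (fun a => exists n : nat, f a n = 0).
  by apply: bianalytic_ex => n; apply: (@bianalytic_cont _ (fun m => m = 0)).
apply: bianalytic_and; apply: bianalytic_imp; try exact: bianalytic_cst; first exact: h.
exact: bianalytic_not.
Qed.

Lemma bianalytic_step e env c :
  bianalytic (fun a => step (member (fx a)) (member_value (fx a)) (omega_app (member
      (fx a))) (claims (fx a)) e env c).
Proof.
rewrite /step; case: (instr_of e).
- case: env => [|[] *]; exact: bianalytic_cst.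
- move=> q; exact: bianalytic_cst.
- case: env => [|[] *]; exact: bianalytic_cst.
- by move=> d1 d2; apply: bianalytic_ex2 => b; apply: bianalytic_claims.
- move=> d1 d2; case: env => [|[[|n]|?||| ] env']; try exact: bianalytic_cst.
    exact: bianalytic_claims.
  by apply: bianalytic_ex2 => b; apply: bianalytic_claims.
- move=> d pi; apply: bianalytic_and; first exact: bianalytic_cst.
  exact: bianalytic_claims.
- move=> i ds; case: (onth env i) => [it|]; last exact: bianalytic_cst.
  case: it => [n|j|||]; last exact: bianalytic_omega.
  + exact: bianalytic_cst.
  + case: ds => [|d [|? ?]]; try exact: bianalytic_cst.
    apply: bianalytic_ex2 => b; first exact: bianalytic_claims.
    by apply: bianalytic_eqn; apply: contR_member.
  + case: ds => [|d [|? ?]]; try exact: bianalytic_cst.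
    apply: bianalytic_ex2 => j; last by apply: bianalytic_eqn; apply: cont_value.
    by apply: bianalytic_all => n; apply: bianalytic_claims_cont; apply: contR_member.
  + case: ds => [|d [|? ?]]; try exact: bianalytic_cst.
    apply: bianalytic_ex2 => j; last by apply: bianalytic_E2; apply: contR_member.
    by apply: bianalytic_all => n; apply: bianalytic_claims_cont; apply: contR_member.
- move=> k; case: env => [|[m|?||| ] env']; try exact: bianalytic_cst.
  by apply: bianalytic_and; [apply: bianalytic_cst|apply: bianalytic_claims].
- exact: bianalytic_cst.
Qed.

Lemma bianalytic_saturated : bianalytic (fun a => saturated (fZ a) (fx a)).
Proof.
have hB j l : contR (fun a => base_member (member
    (fx a) j) l) by exact/contR_component/contR_member.
have hb j l : cont (fun a => base_value (member (fx a) j) l) by exact: contR_member.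
apply: bianalytic_all => kappa; apply: bianalytic_all => N;
    apply: bianalytic_ex => j /=.
have hu : contR (fun a => query (fZ a) kappa (mkseq (member (fx a)) N)).
  by apply: contR_query => // i; apply: contR_member.
have hS s : contR (fun a => part_problem (query (fZ a) kappa (mkseq (member (fx a)) N))
    (base_member (member (fx a) j)) (base_value (member (fx a) j)) s).
  by apply: contR_problem => // l; [apply: hB|apply: hb].
have hdom s s' k : bianalytic (fun a => comparison table_tree
    (part_problem (query (fZ a) kappa (mkseq (member (fx a)) N)) (base_member
        (member (fx a) j)) (base_value (member (fx a) j)) s)
    (part_problem (query (fZ a) kappa (mkseq (member (fx a)) N)) (base_member
        (member (fx a) j)) (base_value (member (fx a) j)) s')
    (member (fx a) k)).
  by apply: bianalytic_comparison => //; apply: contR_member.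
have hval k t t' : bianalytic (fun a => table_says (member (fx a) k) t t').
  by apply: bianalytic_table_says; apply: contR_member.
apply: bianalytic_and; last apply: bianalytic_and.
- apply: bianalytic_all => l; apply: bianalytic_ex => k; apply: bianalytic_and.
    by apply: bianalytic_eqR; [apply: hB|apply: contR_member].
  apply: (@bianalytic_cont _ (fun x => x.1 =
      x.2) (fun a => (base_value (member (fx a) j) l, member_value (fx a) k))).
  apply: (@cont_app _ _ (fun a y => (base_value (member (fx a) j) l, y)));
      last exact: cont_value.
  by move=> y; apply: (@cont_map _ _ (fun x => (x, y))); apply: hb.
- apply: bianalytic_all => s; apply: bianalytic_all => i; apply: bianalytic_ex => k;
    apply: bianalytic_and => //.
  apply: bianalytic_comparison => //; last exact: contR_member.
  by apply: contR_problem => // -[|l] /=;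
      [apply: contR_member|apply: hB|apply: cont_value|apply: hb].
have hnd s0 i s : bianalytic (fun a => undominated (fx a) (query (fZ a) kappa (mkseq
    (member (fx a)) N))
    (base_member (member (fx a) j)) (base_value (member (fx a) j)) s0 i s).
  apply: bianalytic_all => s'; apply: bianalytic_imp; first exact: bianalytic_cst.
  by apply: bianalytic_ex => k; apply: bianalytic_and => //; apply: bianalytic_not.
apply: bianalytic_all => s0; apply: bianalytic_all => i; apply: bianalytic_or.
  apply: bianalytic_ex => s1; apply: bianalytic_ex => s2; apply: bianalytic_and;
      first exact: bianalytic_cst.
  by apply: bianalytic_and; [apply: bianalytic_cst|apply: bianalytic_and].
apply: bianalytic_ex => k; apply: bianalytic_all => s; apply: bianalytic_imp;
    first exact: bianalytic_cst.
apply: bianalytic_or.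
  apply: bianalytic_ex2 => s'; first exact: bianalytic_cst.
  by apply: bianalytic_ex => k'; apply: bianalytic_and.
apply: bianalytic_all => k'; apply: bianalytic_imp; first exact: bianalytic_cst.
by apply: bianalytic_eqn; apply: contR_member.
Qed.

Lemma bianalytic_good : bianalytic (fun a => good_struct (fZ a) (fx a)).
Proof.
apply: bianalytic_and; last apply: bianalytic_and; last exact: bianalytic_saturated.
  apply: bianalytic_all => i; apply: bianalytic_all => j; apply: bianalytic_imp.
    by apply: bianalytic_eqR; apply: contR_member.
  apply: (@bianalytic_cont _ (fun x => x.1 = x.2) (fun a => (member_value (fx a) i,
      member_value (fx a) j))).
  apply: (@cont_app _ _ (fun a y => (member_value (fx a) i, y)));
      last exact: cont_value.
  by move=> y; apply: (@cont_map _ _ (fun x => (x, y))); apply: cont_value.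
apply: bianalytic_all => e; apply: bianalytic_all => env; apply: bianalytic_all => c.
by apply: bianalytic_imp; [apply: bianalytic_step|apply: bianalytic_claims].
Qed.

End Definable.

Lemma analytic_answers : analytic (fun a => answers (left_half a) (right_half a)).
Proof.
have hl := contR_left_half; have hr := contR_right_half.
apply: bianalytic_analytic.
rewrite /answers /extends_query /meets_goal; apply: bianalytic_and;
    first by apply: bianalytic_good => //; apply: contR_component.
apply: bianalytic_and.
  apply: bianalytic_all => k; apply: bianalytic_imp.
    by apply: (@bianalytic_cont _ (fun n => k < n));
        apply: (contR_component (f := left_half)).
  by apply: bianalytic_eqR; apply: contR_component.
apply: bianalytic_all => b; apply: bianalytic_all => d; apply: bianalytic_all => env;
    apply: bianalytic_imp.
  by apply: (@bianalytic_cont _ (fun n => n = _));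
      apply: (contR_component (f := left_half)).
case: b; first by apply: bianalytic_not; apply: bianalytic_claims.
apply: bianalytic_all => n; apply: bianalytic_all => c; apply: bianalytic_imp;
    first exact: bianalytic_claims.
by apply: bianalytic_eqn; apply: contR_member.
Qed.

(** Here E u z says that z is an answer to u, in its left half, with a witness in
    its right half. *)
Definition solvable (E : baire -> baire -> Prop) (v : baire) : Prop :=
  exists z, initial (problem_prefix v) z /\ (E (problem_query v) z /\
    forall i l, member (left_half z) i = problem_member v l ->
        member_value (left_half z) i = problem_value v l).

Lemma analytic_and P Q : analytic P -> analytic Q -> analytic (fun a => P a /\ Q a).
Proof.
move=> hP hQ; apply: (@eq_analytic (fun a => forall b : bool, if b then P a else Q a)).
  by move=> a; split=> [h|[h1 h2] []//]; split; [apply: (h true)|apply: (h false)].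
by apply: analytic_all => -[].
Qed.

Lemma analytic_solvable E : closed_rel E -> analytic (solvable E).
Proof.
move=> E_closed; have hl := contR_left_half; have hr := contR_right_half.
have hlr : contR (fun c => left_half (right_half c)) := contR_comp hl hr.
apply: analytic_ex_baire; apply: analytic_and.
  apply: (@eq_analytic (fun c => exists s, problem_prefix (left_half c) = s /\
      initial s (right_half c))).
    by move=> c; split=> [[s [-> ]]|h] //; exists (problem_prefix (left_half c)).
  apply: analytic_ex => s; apply: analytic_and.
    apply: bianalytic_analytic.
    apply: (@bianalytic_cont _ (fun n => odflt [::] (unpickle n) = s)
      (fun c => component (left_half c) 3 0 0)).
    exact: contR_component.
  apply: bianalytic_analytic.
  by apply: (@bianalytic_cont _ (fun x => x = s)); apply: cont_mkseq.
apply: analytic_and; first by apply: analytic_closed => //; apply: contR_component.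
apply: bianalytic_analytic.
apply: bianalytic_all => i; apply: bianalytic_all => l; apply: bianalytic_imp.
  by apply: bianalytic_eqR; apply: contR_component.
apply: (@bianalytic_cont _ (fun x => x.1 = x.2)
   (fun c => (member_value (left_half (right_half c)) i,
       problem_value (left_half c) l))).
apply: (@cont_app _ _ (fun c y => (member_value (left_half (right_half c)) i, y))).
  by move=> y; apply: (@cont_map _ _ (fun x => (x, y))); apply: cont_value.
exact: (contR_component (f := left_half)).
Qed.

Lemma take_mkseq T (w : nat -> T) k n : k <= n -> take k (mkseq w n) = mkseq w k.
Proof. by move=> kn; rewrite /mkseq -map_take take_iota (minn_idPl kn). Qed.

Lemma agree_mkseq n (a b : baire) : agree n a b <-> mkseq a n = mkseq b n.
Proof.
split=> [h|h k kn]; last by rewrite -(nth_mkseq 0 a kn) h nth_mkseq.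
by apply/eq_in_map => k; rewrite mem_iota add0n /= => /h.
Qed.

(** An analytic set of problems is decided by the trees of a single table. The
    table is found after the set, so the set has to treat the table as a
    component of the problem; this is what makes the self-reference
    harmless. *)
Lemma analytic_tree P : analytic P ->
    exists Z, forall v, query_table (problem_query v) = Z ->
  (P v <-> exists w, forall n, table_tree v (mkseq w n)).
Proof.
move=> [D cD hD].
pose C s t := `[< exists a w, [/\ mkseq a (size s) = s,
    mkseq w (size t) = t & D a w] >].
exists (fun n => if (unpickle n : option (seq nat * seq nat)) is Some (s, t) then
  C s t : nat else 0) => v Zv.
have hC w n : table_tree v (mkseq w n) <-> forall k, k <= n ->
    C (mkseq v k) (mkseq w k).
  rewrite /table_tree Zv size_mkseq; split=> [/allP h k kn|h].
    have := h k; rewrite mem_iota add0n /= ltnS pickleK eqb0 negbK => /(_ kn).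
    by rewrite take_mkseq.
  apply/allP => k; rewrite mem_iota add0n /= ltnS pickleK eqb0 negbK => kn.
  by rewrite take_mkseq //; apply: h.
split=> [/hD [w Dw]|[w h]].
  exists w => n; apply/hC => k _; apply/asboolP; exists v, w.
  by rewrite !size_mkseq.
apply/hD; exists w; apply: cD => n.
have /(hC w n) /(_ n (leqnn n)) /asboolP [a' [w' []]] := h n.
rewrite !size_mkseq => h1 h2 h3; exists a', w'.
by split=> //; apply/agree_mkseq.
Qed.

(** Closing the circle: E describes good structures for an arbitrary table, and Z
    is the table of the problems defined from E. *)
Lemma tree_table : exists E Z, [/\ closed_rel E,
  forall u y, answers u y <-> exists2 z, left_half z = y & E u z &
  forall v, query_table (problem_query v) = Z ->
    (solvable E v <-> exists w, forall n, table_tree v (mkseq w n))].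
Proof.
have [D cD hD] := analytic_answers.
pose E u z := D (interleave u (left_half z)) (right_half z).
have E_closed : closed_rel E.
  move=> u z H; apply: cD => n; have [u' [z' [h1 h2 h3]]] := H n.*2.+1.
  have nn : n <= n.*2.+1 by rewrite -addnn -addnS leq_addr.
  exists (interleave u' (left_half z')), (right_half z'); split=> //.
    apply: agree_interleave; first exact: agree_leq h1.
    by move=> k kn; apply: h2; rewrite ltnS leq_double ltnW.
  by move=> k kn; apply: h2; rewrite ltnS ltn_double.
have [Z hZ] := analytic_tree (analytic_solvable E_closed).
exists E, Z; split=> // u y.
have := hD (interleave u y); rewrite left_half_interleave right_half_interleave =>
    ->; split=> [[w h]|[z <- h]].
  by exists (interleave y w); rewrite /E ?left_half_interleave ?right_half_interleave.
by exists (right_half z).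
Qed.

(** * Every function and finite list of reals extend to a good structure *)

Notation zero_point := (fun=> 0 : nat).

Lemma inj_unbounded (f : nat -> nat) N : injective f -> exists k, N <= f k.
Proof.
move=> inj_f; apply: contrapT => /forallNP H.
have H' k : f k < N by rewrite ltnNge; apply/negP.
suff : size (map f (iota 0 N.+1)) <= size
    (iota 0 N) by rewrite size_map !size_iota ltnn.
apply: uniq_leq_size; first by rewrite map_inj_uniq ?iota_uniq.
by move=> _ /mapP[k _ ->]; rewrite mem_iota add0n H'.
Qed.

Section Enum.
Variables (T : countType) (op : T -> seq baire -> baire) (L0 : seq baire).

(** Stage n serves the triple (t, N, k) coded by n. The component k repeats each
    demand infinitely often, so that it is also served at a stage where N
    reals are present. *)
Definition enum_next n (L : seq baire) : baire :=
  if (unpickle n : option (T * nat * nat)) is Some (t, N, k) then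
    if N <= size L then op t (take N L) else zero_point
  else zero_point.

Fixpoint enum_upto n : seq baire :=
  if n is n'.+1 then rcons (enum_upto n') (enum_next n' (enum_upto n'))
  else L0.

Lemma size_enum n : size (enum_upto n) = size L0 + n.
Proof. by elim: n => [|n ih] /=; rewrite ?addn0 // size_rcons ih addnS. Qed.

Definition enum_seq i : baire := nth zero_point (enum_upto i.+1) i.

Lemma nth_enum n i : i < size L0 + n -> nth zero_point (enum_upto n) i = enum_seq i.
Proof.
have H m k : i < size L0 + m -> nth zero_point (enum_upto (m + k)) i =
    nth zero_point (enum_upto m) i.
  move=> im; elim: k => [|k ih]; first by rewrite addn0.
  rewrite addnS /= nth_rcons size_enum ih.
  by rewrite addnA (leq_trans im) // leq_addr.
move=> h; rewrite /enum_seq; have [ni|ni] := leqP n i.+1.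
  by rewrite -(subnKC ni) H.
by rewrite -(subnKC (ltnW ni)) H // addnS ltnS leq_addl.
Qed.

Lemma enum_op t N : exists j, enum_seq j = op t (mkseq enum_seq N).
Proof.
have [k hk] : exists k : nat, N <= pickle (t, N, k).
  have inj : injective (fun k : nat => pickle (t, N, k)).
    by move=> k k' /(pcan_inj (@pickleK _)) [].
  exact: inj_unbounded N inj.
set n := pickle (t, N, k) in hk *.
exists (size L0 + n); rewrite -(nth_enum (n := n.+1)) ?addnS //= nth_rcons.
rewrite size_enum ltnn eqxx /enum_next /n pickleK -/n size_enum.
have Nn : N <= size L0 + n by apply: leq_trans hk _; apply: leq_addl.
rewrite Nn; congr (op t _); apply: (@eq_from_nth _ zero_point).
  by rewrite size_mkseq size_takel // size_enum.
move=> i; rewrite size_takel ?size_enum // => iN.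
rewrite nth_take // nth_mkseq // nth_enum //.
exact: leq_trans iN Nn.
Qed.

End Enum.

Lemma enum_demands (T : countType) (Req : T -> seq baire -> baire ->
    Prop) (L0 : seq baire) :
  (forall t L, exists r, Req t L r) ->
  exists m : nat -> baire, (forall i, i < size L0 -> m i = nth zero_point L0 i) /\
    forall t N, exists j, Req t (mkseq m N) (m j).
Proof.
move=> h; have /choice [op hop] : forall tL : T * seq baire, exists r, Req tL.1 tL.2 r.
  by move=> [t L]; apply: h.
exists (enum_seq (fun t L => op (t, L)) L0); split.
  by move=> i iL; rewrite -(nth_enum _ (n := 0)) ?addn0.
move=> t N; have [j hj] := enum_op (fun t L => op (t, L)) L0 t N.
by exists j; rewrite hj; apply: (hop (t, _)).
Qed.

Definition env_of (m : nat -> baire) (env : seq (item nat)) := map (item_map m) env.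

(** The closure properties of the structure to be built, as demands for a real
    depending on a finite list of reals already present: a point at which a
    computation does not give 0 (possibly off a given point), the base of a
    query and its points, tables comparing problems, and the limits needed for
    sat_lim. *)
Inductive demand :=
  | Refute of nat & seq (item nat)
  | RefuteOff of nat & seq (item nat) & nat
  | Base of nat
  | BaseMember of nat & nat
  | CompareParts of nat & nat & seq nat & seq nat
  | ComparePoint of nat & nat & seq nat & nat
  | Limit of nat & seq nat & nat.

Definition demand_code (t : demand) :=
  match t with
  | Refute d env => inl (inl (inl (inl (d, env))))
  | RefuteOff d env j => inl (inl (inl (inr (d, env, j))))
  | Base kappa => inl (inl (inr (inl kappa)))
  | BaseMember kappa l => inl (inl (inr (inr (kappa, l))))
  | CompareParts kappa N s s' => inl (inr (kappa, N, s, inl s'))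
  | ComparePoint kappa N s j => inl (inr (kappa, N, s, inr j))
  | Limit kappa s0 i => inr (kappa, s0, i)
  end.

Definition demand_decode c : demand :=
  match c with
  | inl (inl (inl (inl (d, env)))) => Refute d env
  | inl (inl (inl (inr (d, env, j)))) => RefuteOff d env j
  | inl (inl (inr (inl kappa))) => Base kappa
  | inl (inl (inr (inr (kappa, l)))) => BaseMember kappa l
  | inl (inr (kappa, N, s, inl s')) => CompareParts kappa N s s'
  | inl (inr (kappa, N, s, inr j)) => ComparePoint kappa N s j
  | inr (kappa, s0, i) => Limit kappa s0 i
  end.

Lemma demand_codeK : cancel demand_code demand_decode.
Proof. by case. Qed.

HB.instance Definition _ := Countable.copy demand (can_type demand_codeK).

Section Skolem.
Variables (Z : baire) (F : baire -> nat).

(** For every prefix, the part of B for it minimizes the rank among all countable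
    sets of constraints that are true of F. *)
Definition base_ok (kappa : nat) (L : seq baire) (B : baire) : Prop :=
  let u := query Z kappa L in
  (forall l, F (base_member B l) = base_value B l) /\
  forall s bm bv, (forall l, F (bm l) = bv l) ->
    rank_le table_tree (part_problem u (base_member B) (base_value B) s,
        [::]) (problem u bm bv s, [::]).

Lemma base_ex kappa L : exists B, base_ok kappa L B.
Proof.
set u := query Z kappa L.
have /choice [b hb] : forall s, exists bm : nat -> baire, forall bm' : nat -> baire,
    rank_le table_tree (problem u bm (F \o bm) s, [::]) (problem u bm' (F \o bm') s,
        [::]).
  move=> s; have [|_ [bm ->] h] :=
    @rank_min table_tree (fun v => exists bm, v = problem u bm (F \o bm) s).
    by exists (problem u (fun=> zero_point) (F \o (fun=> zero_point)) s),
        (fun=> zero_point).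
  by exists bm => bm'; apply: h; exists bm'.
pose bm l := if (unpickle l : option (seq nat * nat)) is Some (s,
    l') then b s l' else zero_point.
exists (assemble (fun t l => if t is 0 then bm l else (fun=> F (bm l)))).
have E1 : base_member (assemble (fun t l => if t is 0 then bm l else (fun=> F
    (bm l)))) = bm.
  by apply: funext => l; rewrite /base_member component_assemble.
have E2 : base_value (assemble (fun t l => if t is 0 then bm l else (fun=> F
    (bm l)))) = F \o bm.
  by apply: funext => l; rewrite /base_value component_assemble.
rewrite /base_ok E1 E2; split=> // s bm' bv' hbv'.
have -> : bv' = F \o bm' by apply: funext => l; rewrite -hbv'.
have -> : part_problem u bm (F \o bm) s = problem u (b s) (F \o b s) s; last exact: hb.
have e : part bm s = b s by apply: funext => l; rewrite /part /bm pickleK.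
rewrite /part_problem e; congr (problem u _ _ s); apply: funext => l.
by rewrite /part /= -e.
Qed.

Variable base_of : nat -> seq baire -> baire.

Definition base_problem kappa L s := part_problem (query Z kappa L) (base_member
    (base_of kappa L)) (base_value (base_of kappa L)) s.

Definition rank_dominated kappa L s0 i s : Prop := exists2 s', prefix s0 s' /\
    incompat i s s' &
  rank_le table_tree (base_problem kappa L s, [::]) (base_problem kappa L s', [::]).

Definition faithful_table v v' r : Prop := comparison table_tree v v' r /\
  (table_says r [::] [::] <-> rank_le table_tree (v, [::]) (v', [::])).

Definition meets_demand (t : demand) (L : seq baire) (r : baire) : Prop :=
  match t with
  | Refute d env =>
      let renv := env_of (nth zero_point L) env in
      (exists g, ~ evo F d (AFun g :: renv) 0) ->
      ~ evo F d (AFun r :: renv) 0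
  | RefuteOff d env j =>
      let renv := env_of (nth zero_point L) env in
      (exists g, ~ evo F d (AFun g :: renv) 0 /\ g <> nth zero_point L j) ->
      ~ evo F d (AFun r :: renv) 0 /\ r <> nth zero_point L j
  | Base kappa => r = base_of kappa L
  | BaseMember kappa l => r = base_member (base_of kappa L) l
  | CompareParts kappa N s s' =>
      let L := take N L in faithful_table (base_problem kappa L s)
          (base_problem kappa L s') r
  | ComparePoint kappa N s j =>
      let m := nth zero_point L j in let L := take N L in
      faithful_table (base_problem kappa L s) (problem (query Z kappa L) (scons m
          (base_member (base_of kappa L)))
        (scons (F m) (base_value (base_of kappa L))) s) r
  | Limit kappa s0 i =>
      (exists s1 s2, (prefix s0 s1 /\ prefix s0 s2) /\
         (incompat i s1 s2 /\ (~ rank_dominated kappa L s0 i s1 /\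
             ~ rank_dominated kappa L s0 i s2)))
      \/ forall s, prefix s0 s ->
         rank_dominated kappa L s0 i s \/ forall k, digit_pos i k < size s ->
             nth 0 s (digit_pos i k) = r k
  end.

Lemma faithful_table_ex v v' : exists r, faithful_table v v' r.
Proof. by have [r [h1 h2]] := comparison_ex table_tree v v'; exists r. Qed.

Lemma demand_ex t L : exists r, meets_demand t L r.
Proof.
case: t => [d env|d env j|kappa|kappa l|kappa N s s'|kappa N s j|kappa s0 i] /=.
- case: (pselect (exists g, ~ evo F d (AFun g :: env_of (nth zero_point L) env) 0)).
    by move=> [g hg]; exists g.
  by move=> h; exists zero_point => /h.
- case: (pselect (exists g, ~ evo F d (AFun g :: env_of (nth zero_point L) env) 0
    /\ g <> nth zero_point L j)).
    by move=> [g hg]; exists g.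
  by move=> h; exists zero_point => /h.
- by eexists.
- by eexists.
- exact: faithful_table_ex.
- exact: faithful_table_ex.
case: (pselect (exists s1 s2, (prefix s0 s1 /\ prefix s0 s2) /\
  (incompat i s1 s2 /\ (~ rank_dominated kappa L s0 i s1 /\
      ~ rank_dominated kappa L s0 i s2)))) => [h|h].
  by exists zero_point; left.
have /choice [r hr] : forall k, exists a, forall s, prefix s0 s ->
    ~ rank_dominated kappa L s0 i s -> digit_pos i k < size s ->
        nth 0 s (digit_pos i k) = a.
  move=> k; case: (pselect (exists s, [/\ prefix s0 s, ~ rank_dominated kappa L s0 i s
      & digit_pos i k < size s])) => [[s [h1 h2 h3]]|h'].
    exists (nth 0 s (digit_pos i k)) => s' h1' h2' h3'; apply: contrapT => ne.
    by apply: h; exists s', s; split=> //; split=> //; exists k.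
  by exists 0 => s h1 h2 h3; case: h'; exists s.
exists r; right=> s hs; case: (pselect (rank_dominated kappa L s0 i s)) => h';
    [by left|right].
by move=> k; apply: hr.
Qed.

End Skolem.

Lemma env_bound (env : seq (item nat)) : exists N,
  forall (m m' : nat -> baire), (forall i, i < N -> m i = m' i) ->
  env_of m env = env_of m' env.
Proof.
elim: env => [|t env [N hN]]; first by exists 0.
case: t => [n|k|||]; try by exists N => m m' h;
    rewrite /env_of /= -!/(env_of _ env) (hN m m').
exists (maxn k.+1 N) => m m' h; rewrite /env_of /= -!/(env_of _ env) (hN m m').
  by rewrite h // leq_maxl.
by move=> i iN; apply: h; apply: leq_trans (leq_maxr _ _).
Qed.

(** A Loewenheim-Skolem argument: the true evaluations, restricted to a countable
    set closed under all demands, form a good structure. *)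
Lemma skolem Z F L0 : exists x, [/\ good_struct Z x, forall i,
    member_value x i = F (member x i),
  forall e env a, claims x e env a <-> evo F e (env_of (member x) env) a &
  forall i, i < size L0 -> member x i = nth zero_point L0 i].
Proof.
have /choice [base' base'P] : forall kL : nat * seq baire, exists B,
    base_ok Z F kL.1 kL.2 B.
  by move=> [kappa L]; apply: base_ex.
pose base_of kappa L := base' (kappa, L).
have base_ofP kappa L : base_ok Z F kappa L (base_of kappa L) by apply:
    (base'P (kappa, L)).
have [m [mL0 hm]] := @enum_demands demand (meets_demand Z F base_of) L0
    (demand_ex Z F base_of).
pose V c := if (unpickle c : option (nat * seq (item nat) * nat)) is Some (e, env, a)
  then `[< evo F e (env_of m env) a >] : nat else 0.
pose x := assemble (fun t i => match t with
  | 0 => m i | 1 => (fun=> F (m i)) | _ => (fun=> V i) end).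
have xm i : member x i = m i by rewrite /member component_assemble.
have xq i : member_value x i = F (m i) by rewrite /member_value component_assemble.
have xV e env a : claims x e env a <-> evo F e (env_of m env) a.
  by rewrite /claims component_assemble /V pickleK; case: asboolP.
have xmm : member x = m by apply: funext.
exists x; split; rewrite ?xmm //.
have env_nth env : exists N, env_of (nth zero_point (mkseq m N)) env = env_of m env.
  have [N hN] := env_bound env; exists N; apply: hN => i iN.
  by rewrite nth_mkseq.
have env_nth2 env j : exists N,
    env_of (nth zero_point (mkseq m N)) env = env_of m env /\ j < N.
  have [N hN] := env_bound env; exists (maxn N j.+1); split; last exact: leq_maxr.
  by apply: hN => i iN; rewrite nth_mkseq // (leq_trans iN) // leq_maxl.
split; first by move=> i j; rewrite !xq !xm => ->.
split.
  move=> e env a; rewrite xmm => st; apply/xV; apply: evI; move: st; rewrite /step.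
  case: (instr_of e) => //=.
  + by case: env => [|[]] //.
  + by case: env => [|[]] //.
  + by move=> d1 d2 [b /xV h2 /xV h1]; exists b.
  + move=> d1 d2; case: env => [//|[[|n]|?||| ] env'] //=; first by move/xV.
    by move=> [b /xV h1 /xV h2]; exists b.
  + move=> d pi [h1 /xV h2]; split; first by rewrite size_map.
    move: h2; congr (ev _ _ _ _ _); rewrite /env_of -map_comp; apply/eq_in_map => i.
    rewrite (perm_mem h1) mem_iota add0n /= => hi.
    by rewrite (nth_map (ANum 0)).
  + move=> i ds; rewrite onth_map; case: (onth env i) => [it|//] /=.
    case: it => [n|j|||]; case: ds => [|d [|d2 [|? ?]]] //=.
    * by move=> [b /xV h ->]; exists b.
    * move=> [j h ->]; exists (m j); last exact: xq.
      by move=> n; have /xV := h n.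
    * move=> [j h ->]; exists (m j) => //.
      by move=> n; have /xV := h n.
    * move=> [n /xV hn h]; exists n => //; case: h => [[j0 /xV h0 [h ->]]|[h ->]].
        left; exists (m j0) => //; split=> // g;
            case: (pselect (g = m j0)) => [->|ng]; first by right.
        left; apply: contrapT => ne.
        have [N [hN jN]] := env_nth2 env j0.
        have [j] := hm (RefuteOff d env j0) N.
        rewrite /= hN nth_mkseq // => hj.
        have [] : ~ evo F d (AFun (m j) :: env_of m env) 0 /\ m j <> m j0.
          by apply: hj; exists g.
        by case: (h j) => [/xV|].
      right; split=> // g; apply: contrapT => ne.
      have [N hN] := env_nth env.
      have [j] := hm (Refute d env) N.
      rewrite /= hN => hj; apply: hj; first by exists g.
      by have /xV := h j.
  + move=> k; case: env => [//|[n|?||| ] env'] //= [h1 /xV h2].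
    by rewrite size_map -map_take.
move=> kappa N; rewrite xmm.
set L := mkseq m N.
have [jB /= hjB] := hm (Base kappa) N.
exists jB => /=; rewrite hjB -/L.
have [hBF hBmin] := base_ofP kappa L.
have tab s s' : exists j, faithful_table (base_problem Z base_of kappa L s)
    (base_problem Z base_of kappa L s') (m j).
  have [j /=] := hm (CompareParts kappa N s s') N.
  by rewrite take_mkseq // => h; exists j.
split; last split.
- move=> l; have [j /= hj] := hm (BaseMember kappa l) N.
  by exists j; rewrite xm hj xq hj hBF.
- move=> s j; have [k /=] := hm (ComparePoint kappa N s j) (maxn N j.+1).
  rewrite nth_mkseq ?leq_maxr // take_mkseq ?leq_maxl // -/L => -[h1 h2].
  exists k; rewrite !xm xq; split=> //; apply/h2; apply: hBmin.
  by case=> [|l] //=; apply: hBF.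
move=> s0 i; have [j /=] := hm (Limit kappa s0 i) N; rewrite -/L.
case=> [[s1 [s2 [hp [hi [n1 n2]]]]]|h].
  left; exists s1, s2; split=> //; split=> //.
  have H s : ~ rank_dominated Z base_of kappa L s0 i s ->
      undominated x (query Z kappa L) (base_member (base_of kappa L)) (base_value
          (base_of kappa L)) s0 i s.
    move=> ns s' hs'; have [k [h1 h2]] := tab s s'; exists k; rewrite xm; split=> //.
    by move=> /h2 h3; apply: ns; exists s'.
  by split; apply: H.
right; exists j => s /h [[s' hs' le]|hs]; last by right; rewrite xm.
left; exists s' => //; have [k [h1 h2]] := tab s s'; exists k; rewrite xm.
by split=> //; apply/h2.
Qed.

(** * Compatible answers to a query *)

Lemma prefix_nth (s s' : seq nat) k : prefix s s' -> k < size s ->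
  nth 0 s' k = nth 0 s k.
Proof. by move=> /prefixP[t ->] h; rewrite nth_cat h. Qed.

Lemma initial_nth s z k : initial s z -> k < size s -> nth 0 s k = z k.
Proof. by move=> <-; rewrite size_mkseq => h; rewrite nth_mkseq. Qed.

Lemma initial_prefix s s' z : prefix s s' -> initial s' z -> initial s z.
Proof.
move=> /prefixP[t ->]; rewrite /initial size_cat => h.
have := congr1 (take (size s)) h.
by rewrite take_mkseq ?leq_addr // take_size_cat.
Qed.

Lemma initial_mkseq s z n : initial s z -> size s <= n -> prefix s (mkseq z n).
Proof.
move=> <-; rewrite size_mkseq => h; rewrite -(take_mkseq z h).
exact: prefix_take.
Qed.

Definition agrees (F : baire -> nat) (x : baire) : Prop :=
  forall i, F (member x i) = member_value x i.

Lemma override F y : consistent y ->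
  exists2 F', agrees F' y &
    forall g, (forall i, g = member y i -> F g = member_value y i) -> F' g = F g.
Proof.
move=> cy; have /choice [F' hF'] : forall g, exists a,
    (forall i, g = member y i -> a = member_value y i) /\
    ((forall i, g <> member y i) -> a = F g).
  move=> g; case: (pselect (exists i, g = member y i)) => [[i ->]|h].
    by exists (member_value y i); split=> [j /cy|/(_ i)].
  by exists (F g); split=> // i e; case: h; exists i.
exists F' => [i|g h]; first by case: (hF' (member y i)) => /(_ i erefl).
have [h1 h2] := hF' g; case: (pselect (exists i, g = member y i)) => [[i e]|ne].
  by rewrite (h1 _ e) (h _ e).
by apply: h2 => i e; apply: ne; exists i.
Qed.

Section Basis.
Variables (E : baire -> baire -> Prop) (Z : baire).
Hypothesis E_closed : closed_rel E.
Hypothesis E_answers : forall u y, answers u y <-> exists2 z, left_half z = y & E u z.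
Hypothesis Z_solvable : forall v, query_table (problem_query v) = Z ->
  (solvable E v <-> exists w, forall n, table_tree v (mkseq w n)).

Lemma solvable_wellfounded v : query_table (problem_query v) = Z ->
    solvable E v <-> ~ wellfounded table_tree v [::].
Proof.
move=> /Z_solvable ->; split=> [[w]|]; first exact: path_not_wellfounded.
by apply: not_wellfounded_path; apply: tree_rcons.
Qed.

Lemma solvableE u b c s : solvable E (problem u b c s) <->
    exists z, initial s z /\ (E u z /\
    forall i l, member (left_half z) i = b l -> member_value (left_half z) i = c l).
Proof.
rewrite /solvable problem_prefix_problem problem_query_problem;
    split=> -[z [h1 [h2 h3]]]; exists z; split=> //; split=> //.
  by move=> i l; have := h3 i l; rewrite problem_member_problem problem_value_problem.
by move=> i l; rewrite problem_member_problem problem_value_problem; apply: h3.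
Qed.

Section Point.
Variables (x : baire) (kappa N : nat) (B : baire).
Let u := query Z kappa (mkseq (member x) N).
Let bm := base_member B.
Let bv := base_value B.
Hypothesis hmin : sat_min x u bm bv.
Hypothesis hlim : sat_lim x u bm bv.

Definition meets z := forall i l, member (left_half z) i = bm l ->
    member_value (left_half z) i = bv l.

(** The prefixes that can be continued to an answer. The constraints differ from
    prefix to prefix, but by alive_point the choice does not matter. *)
Definition alive s := solvable E (part_problem u bm bv s).

Lemma query_table_problem b c s : query_table (problem_query (problem u b c s)) = Z.
Proof. by rewrite problem_query_problem query_table_query. Qed.

Lemma alive_wellfounded s : alive s <->
    ~ wellfounded table_tree (part_problem u bm bv s) [::].
Proof. by apply: solvable_wellfounded; apply: query_table_problem. Qed.

Lemma alive_mkseq z s n : E u z -> meets z -> initial s z -> size s <= n ->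
  alive (mkseq z n) /\ prefix s (mkseq z n).
Proof.
move=> Ez mz sz sn; split; last exact: initial_mkseq.
apply/solvableE; exists z; split; first by rewrite /initial size_mkseq.
by split=> // i l; apply: mz.
Qed.

(** The answer z meets all constraints of the base, hence those reserved for any
    of its own prefixes, so that all its prefixes are alive; in addition it
    agrees with x at one more point. *)
Lemma alive_point s j : alive s -> exists z, initial s z /\ (E u z /\ (meets z /\
  forall i, member (left_half z) i = member x j ->
      member_value (left_half z) i = member_value x j)).
Proof.
move=> /alive_wellfounded h; have [k [hc hr]] := hmin s j.
have /solvable_wellfounded : ~ wellfounded table_tree (problem u (scons
    (member x j) bm) (scons (member_value x j) bv) s) [::].
  by move=> /(comparison_le hc hr).
rewrite query_table_problem => /(_ erefl) /solvableE [z [h1 [h2 h3]]]; exists z;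
    split=> //; split=> //.
by split=> [i l|i]; [apply: (h3 i l.+1)|apply: (h3 i 0)].
Qed.

Definition forces s (P : baire -> Prop) := exists s',
  [/\ prefix s s', size s < size s', alive s' & forall z, initial s' z -> P z].

Lemma forces_agree s i j : alive s ->
  forces s (fun z => member (left_half z) i = member x j ->
      member_value (left_half z) i = member_value x j).
Proof.
move=> /(alive_point j) [z [sz [Ez [mz hz]]]].
have [k hk] : exists k, forall z', agree k z z' ->
    member (left_half z') i = member x j ->
        member_value (left_half z') i = member_value x j.
  case: (pselect (member (left_half z) i = member x j)) => [/hz e|ne].
    exists ((pickle (1, i, 0)).*2.+1) => z' h _.
    by rewrite -e; apply/esym; apply: h.
  have [k hk] : exists k, member (left_half z) i k <> member x j k.
    by apply: contrapT => /forallNP H; apply: ne; apply: funext => k; apply: contrapT.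
  exists (digit_pos i k).+1 => z' h e; case: hk; rewrite -e.
  exact: h.
have [a1 a2] := alive_mkseq (n := maxn (size s).+1 k) Ez mz sz (leq_trans (leqnSn _)
    (leq_maxl _ _)).
(* k digits decide the property, and one more than size s makes s' longer. *)
exists (mkseq z (maxn (size s).+1 k)); split=> //; first by rewrite size_mkseq leq_maxl.
move=> z'; rewrite /initial size_mkseq => e; apply: hk.
by apply: (agree_leq (leq_maxr (size s).+1 k)); apply/agree_mkseq/esym.
Qed.

(** Otherwise d would be the only possible value of member i beyond s, and x would
    contain it by sat_lim. *)
Lemma forces_avoid s i d : alive s -> (forall j, d <> member x j) ->
  forces s (fun z => member (left_half z) i <> d).
Proof.
move=> As nd; apply: contrapT => nF.
(* Answers beyond s have no choice for member i. *)
have U z : initial s z -> E u z -> meets z -> member (left_half z) i = d.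
  move=> sz Ez mz; apply: funext => k; apply: contrapT => ne; apply: nF.
  set n := maxn (size s).+1 (digit_pos i k).+1.
  have sn : size s <= n by apply: leq_trans (leqnSn _) (leq_maxl _ _).
  have [a1 a2] := alive_mkseq Ez mz sz sn.
  exists (mkseq z n); split=> //; first by rewrite size_mkseq leq_maxl.
  move=> z' sz' e; apply: ne; rewrite -e.
  have := initial_nth sz' (k := digit_pos i k);
      rewrite size_mkseq leq_maxr nth_mkseq ?leq_maxr //.
  exact.
have V s' k : prefix s s' -> alive s' -> digit_pos i k < size s' ->
    nth 0 s' (digit_pos i k) = d k.
  move=> ss' /(alive_point 0) [z [sz [Ez [mz _]]]] ks.
  by rewrite (initial_nth sz ks) -(U z) //; apply: initial_prefix sz.
have [z [sz [Ez [mz _]]]] := alive_point 0 As.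
have W k : exists s', [/\ prefix s s', alive s' & digit_pos i k < size s'].
  exists (mkseq z (maxn (size s) (digit_pos i k).+1)).
  have [a1 a2] := alive_mkseq (n := maxn (size s) (digit_pos i k).+1) Ez mz sz
      (leq_maxl _ _).
  by split=> //; rewrite size_mkseq leq_maxr.
(* An undominated prefix that contradicts d would be alive, as its rank exceeds that
   of a prefix s' of z; but alive prefixes agree with d. *)
case: (hlim s i) => [[s1 [s2 [[ss1 ss2] [[k [k1 k2 ne]] [n1 n2]]]]]|[j hj]].
  have H s3 : prefix s s3 -> digit_pos i k < size s3 ->
      nth 0 s3 (digit_pos i k) <> d k ->
      ~ undominated x u bm bv s i s3.
    move=> ss3 ks3 ne3 n3; have [s' [ss' As' ks']] := W k.
    have [|jr [hc hr]] := n3 s'.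
      by split=> //; exists k; split=> //; rewrite (V s').
    have /alive_wellfounded As3 : ~ wellfounded table_tree
        (part_problem u bm bv s3) [::].
      by move=> /(comparison_gt hc hr); apply/alive_wellfounded.
    by apply: ne3; apply: V.
  case: (pselect (nth 0 s1 (digit_pos i k) = d k)) => e1; last exact: H n1.
  by apply: H n2 => //; rewrite -e1 => /esym.
apply: (nd j); apply: funext => k; have [s' [ss' As' ks']] := W k.
case: (hj s' ss') => [|/(_ k ks') <-]; last by rewrite (V s').
move=> [s'' [ss'' [k' [k1 k2 ne]]] [jr [hc hr]]]; exfalso; apply: ne.
have /alive_wellfounded As'' : ~ wellfounded table_tree (part_problem u bm bv s'') [::].
  by move=> /(comparison_le hc hr); apply/alive_wellfounded.
by rewrite (V s') // (V s'').
Qed.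

(** A branch through alive prefixes is an answer, since answers form a closed
    set, and it inherits every property forced along the way. *)
Lemma fusion (P : nat -> baire -> Prop) :
  (forall n s, alive s -> forces s (P n)) -> alive [::] ->
  exists2 z, E u z & forall n, P n z.
Proof.
move=> hP A0; have /choice [nx hnx] : forall ns : nat * seq nat, exists s',
    alive ns.2 -> [/\ prefix ns.2 s', size ns.2 < size s', alive s' &
      forall z, initial s' z -> P ns.1 z].
  move=> [n s]; case: (pselect (alive s)) => [/(hP n) [s' h]|h]; last by exists [::].
  by exists s'.
pose s := fix s n := if n is n'.+1 then nx (n', s n') else [::].
have sA n : alive (s n) by elim: n => [//|n /(hnx (n, s n)) []].
have sS n : [/\ prefix (s n) (s n.+1), size (s n) < size (s n.+1) &
    forall z, initial (s n.+1) z -> P n z].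
  by have [] := hnx (n, s n) (sA n).
have size_s n : n <= size (s n).
  by elim: n => [//|n ih]; have [_ h _] := sS n; apply: leq_ltn_trans h.
have sM n k : prefix (s n) (s (n + k)).
  elim: k => [|k ih]; first by rewrite addn0 prefix_refl.
  by rewrite addnS; have [h _ _] := sS (n + k); apply: prefix_trans h.
pose z k := nth 0 (s k.+1) k.
have hz n : initial (s n) z.
  apply: (@eq_from_nth _ 0); rewrite size_mkseq // => k kn.
  rewrite nth_mkseq // /z; have [le|/ltnW le] := leqP n k.+1.
    by rewrite -(subnKC le) (prefix_nth (sM _ _)).
  by rewrite -(subnKC le) (prefix_nth (sM _ _)) // size_s.
exists z; last by move=> n; have [_ _] := sS n; apply.
apply: E_closed => n; have /solvableE [z' [sz' [Ez' _]]] := sA n.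
exists u, z'; split=> // k kn.
have ks : k < size (s n) by apply: leq_trans kn (size_s n).
by rewrite -(initial_nth (hz n) ks) (initial_nth sz' ks).
Qed.

(** The analogue of the Gandy basis theorem: an answer that agrees with x on
    common points and otherwise avoids any given countable set. *)
Lemma avoid_basis (en : nat -> baire) : alive [::] ->
  exists z, [/\ E u z,
    forall i j, member (left_half z) i = member x j ->
        member_value (left_half z) i = member_value x j &
    forall i k, member (left_half z) i = en k -> exists j, en k = member x j].
Proof.
move=> A0; pose P n z := match (unpickle n : option (nat * nat + nat * nat)) with
  | Some (inl (i, j)) => member (left_half z) i = member x j ->
      member_value (left_half z) i = member_value x j
  | Some (inr (i, k)) => member (left_half z) i = en k -> exists j, en k = member x j
  | None => True
  end.
have [|z Ez hz] := @fusion P _ A0.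
  move=> n s As; rewrite /P; case: unpickle => [[[i j]|[i k]]|].
  - exact: forces_agree.
  - case: (pselect (exists j, en k = member x j)) => h.
      have [s' [h1 h2 h3 h4]] := forces_agree 0 0 As; exists s'; split=> //.
    have /forallNP h' := h.
    by have [s' [h1 h2 h3 h4]] := forces_avoid i As h'; exists s'; split=> // z /h4.
  - by have [s' [h1 h2 h3 h4]] := forces_agree 0 0 As; exists s'; split.
exists z; split=> // [i j|i k].
  by have := hz (pickle (inl (i, j) : nat * nat + nat * nat)); rewrite /P pickleK.
by have := hz (pickle (inr (i, k) : nat * nat + nat * nat)); rewrite /P pickleK.
Qed.

End Point.

(** Two answers that are compatible with each other, with x and with p: the second
    one is built to avoid the first one outside x. In particular they have
    different members 0 unless this member already lies in x. *)
Lemma basis x kappa N (p : baire -> Prop) F z0 :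
  let u := query Z kappa (mkseq (member x) N) in
  good_struct Z x -> (exists en : nat -> baire, forall g, p g -> exists k, en k = g) ->
  agrees F x -> E u z0 -> agrees F (left_half z0) ->
  exists z F', [/\ E u z, forall g, p g ->
      F' g = F g, agrees F' x, agrees F' (left_half z) &
    (exists j, member (left_half z) 0 = member x j) \/
    exists z' F'', [/\ E u z', forall g, p g -> F'' g = F g, agrees F'' x &
      [/\ agrees F'' (left_half z), agrees F'' (left_half z') & member
          (left_half z) 0 <> member (left_half z') 0]]].
Proof.
move=> u [cx [_ sx]] [en hen] Fx Ez0 Fz0.
have [jB [hbase [hmin hlim]]] := sx kappa N.
have A0 : alive x kappa N (member x jB) [::].
  apply/solvableE; exists z0; split=> //; split=> // i l e.
  have [j [e1 e2]] := hbase (pickle ([::] : seq nat, l)).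
  by rewrite -Fz0 e /part e1 e2 Fx.
have [z [Ez z1 z2]] := avoid_basis hmin hlim en A0.
have cons w : E u w -> consistent (left_half w).
  by move=> Ew; have /E_answers [[]] : exists2 z,
      left_half z = left_half w & E u z by exists w.
have [F' F'z hF'] := override F (cons _ Ez).
have F'p g : p g -> F' g = F g.
  move=> pg; apply: hF' => i e; have [k ek] := hen g pg.
  have [j ej] : exists j, en k = member x j by apply: (z2 i); rewrite ek.
  by rewrite (z1 i j) -?ej ?ek // -Fx -ej ek.
have F'x : agrees F' x.
  move=> j; rewrite hF' // => i e.
  by rewrite Fx (z1 i j).
exists z, F'; split=> //.
case: (pselect (exists j, member (left_half z) 0 = member x j)) => [|nz];
    [by left|right].
(* The second answer also has to avoid the members of the first one. *)
pose en' n := match (unpickle n : option (nat + nat)) with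
  | Some (inl k) => en k | Some (inr i) => member (left_half z) i | None => en 0 end.
have [z' [Ez' z'1 z'2]] := avoid_basis hmin hlim en' A0.
have en'l k : en' (pickle (inl k : nat + nat)) = en k by rewrite /en' pickleK.
have en'r k : en' (pickle (inr k : nat + nat)) =
    member (left_half z) k by rewrite /en' pickleK.
have [F'' F''z' hF''] := override F' (cons _ Ez').
have F''k k : F'' (en' k) = F' (en' k).
  apply: hF'' => i e; have [j ej] : exists j, en' k = member x j by apply: (z'2 i).
  by rewrite (z'1 i j) -?ej // ej F'x.
have F''z : agrees F'' (left_half z) by move=> i; rewrite -en'r F''k en'r.
exists z', F''; split=> //.
- move=> g pg; have [k ek] := hen g pg.
  by rewrite -ek -en'l F''k en'l ek F'p.
- move=> j; rewrite hF'' // => i e.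
  by rewrite F'x (z'1 i j).
split=> // e; apply: nz.
have [j ej] : exists j, en' (pickle (inr 0 : nat + nat)) = member x j.
  by apply: (z'2 0); rewrite en'r.
by exists j; rewrite -ej en'r.
Qed.

End Basis.

(** * Total functionals computable in Omega are countably based *)

(** Graphs of partial functions, to be extended by type-2 arguments. Countable
    conditions are closed under increasing unions of length omega, and this is
    what makes the induction below possible. *)
Definition condition := baire -> nat -> Prop.
Definition fits (F : baire -> nat) (p : condition) : Prop := forall g v, p g v ->
    F g = v.
Definition with_struct (p : condition) (x : baire) : condition :=
  fun g v => p g v \/ exists i, g = member x i /\ v = member_value x i.
Definition countable_cond (p : condition) : Prop :=
  exists en : nat -> baire, forall g v, p g v -> exists k, en k = g.

Lemma fits_with F p x : fits F (with_struct p x) <-> fits F p /\ agrees F x.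
Proof.
split=> [h|[h1 h2] g v [|[i [-> ->]]]].
- by split=> [g v pg|i]; apply: h; [left|right; exists i].
- exact: h1.
- exact: h2.
Qed.

Lemma countable_with p x : countable_cond p -> countable_cond (with_struct p x).
Proof.
move=> [en hen]; exists (fun n => match (unpickle n : option (nat + nat)) with
  | Some (inl k) => en k | Some (inr i) => member x i | None => en 0 end).
move=> g v [/hen [k <-]|[i [-> _]]].
  by exists (pickle (inl k : nat + nat)); rewrite pickleK.
by exists (pickle (inr i : nat + nat)); rewrite pickleK.
Qed.

Lemma fun_of_graph (G : condition) : (forall g v w, G g v -> G g w -> v = w) ->
  exists F, fits F G.
Proof.
move=> hG; have /choice [F hF] : forall g, exists a, forall v, G g v -> a = v.
  move=> g; case: (pselect (exists v, G g v)) => [[v Gv]|h].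
    by exists v => w; apply: hG.
  by exists 0 => v Gv; case: h; exists v.
by exists F.
Qed.

Definition config : Type := (nat * seq (item baire))%type.

(** c' is a subcomputation of c: every set of premises for c, taken from the true
    evaluations, evaluates c'. *)
Definition needs (F : baire -> nat) (c' c : config) : Prop := forall R a,
  (forall e env b, R e env b -> evo F e env b) ->
  step id F omega_oracle R c.1 c.2 a -> exists b, R c'.1 c'.2 b.

Lemma needs_acc F e env a : evo F e env a -> Acc (needs F) (e, env).
Proof.
elim=> {}e {}env {}a R hR ih st; split=> -[e' env'] h.
by have [b /ih] := h R a hR st.
Qed.

Definition converges (p : condition) (c : config) : Prop :=
  forall F, fits F p -> exists a, evo F c.1 c.2 a.

(** c' is a subcomputation of c for every F that extends p'. The condition may
    grow along with the descent. *)
Definition below (y' y : condition * config) : Prop :=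
  (forall g v, y.1 g v -> y'.1 g v) /\
  ((exists F, fits F y'.1) /\ forall F, fits F y'.1 -> needs F y'.2 y.2).

(** The union of the conditions along an infinite descent is consistent. For an F
    that extends it all steps of the descent are genuine, so that the
    computation of c from F would have an infinite branch; but it converges. *)
Lemma below_acc p c : (exists F, fits F p) -> converges p c -> Acc below (p, c).
Proof.
move=> hp hc; apply: contrapT => nA.
have /choice [nx hnx] : forall y, exists y', ~ Acc below y ->
    below y' y /\ ~ Acc below y'.
  move=> y; case: (pselect (Acc below y)) => [h|h]; first by exists y.
  apply: contrapT => /forallNP H; apply: h; split=> y' b.
  by apply: contrapT => nA'; apply: (H y').
pose s n := iter n nx (p, c).
have sA n : ~ Acc below (s n) by elim: n => [//|n /hnx []].
have sB n : below (s n.+1) (s n) by have [] := hnx _ (sA n).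
have sF n : exists F, fits F (s n).1.
  by case: n => [|n]; [exact: hp|have [_ [h _]] := sB n].
have sM n k g v : (s n).1 g v -> (s (n + k)).1 g v.
  elim: k => [|k ih]; first by rewrite addn0.
  by move=> /ih; rewrite addnS; have [h _] := sB (n + k); apply: h.
(* Any two values are already present at a common stage. *)
have [|F hF] := @fun_of_graph (fun g v => exists n, (s n).1 g v).
  move=> g v w [n hv] [m hw]; have [F hF] := sF (n + m).
  rewrite -(hF g v) ?(hF g w) //; last exact: sM.
  by rewrite addnC; apply: sM.
have Fs n : fits F (s n).1 by move=> g v h; apply: hF; exists n.
have [a ha] := hc F (Fs 0).
suff H y : Acc (needs F) y -> forall n, y <> (s n).2.
  by apply: (H _ (needs_acc ha) 0); rewrite -surjective_pairing.
elim=> {}y _ ih n e; apply: (ih (s n.+1).2 _ n.+1 erefl).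
by rewrite e; have [_ [_ h]] := sB n; apply: h.
Qed.

Lemma omega_total R d1 d2 env a : omega_app id R [:: d1; d2] env a ->
  forall g, exists2 b, R d1 (AFun g :: env) b & b = 0 \/ b = 1.
Proof.
move=> [n _ [[g0 h0 [h _]]|[h _]]] g.
  by case: (h g) => [h'|->]; [exists 0; [|left]|exists 1; [|right]].
by exists 0; [|left].
Qed.

Lemma omega_unique F d1 d2 env a : omega_app id (evo F) [:: d1; d2] env a ->
  forall g g' b b', evo F d1 (AFun g :: env) b -> evo F d1 (AFun g' :: env) b' ->
  b <> 0 -> b' <> 0 -> g = g'.
Proof.
move=> [n _ h] g g' b b' hb hb' nb nb'; case: h => [[g0 h0 [h _]]|[h _]]; last first.
  by case: nb; apply: ev_fun hb (h g).
have H g1 b1 : evo F d1 (AFun g1 :: env) b1 -> b1 <> 0 -> g1 = g0.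
  by move=> h1 n1; case: (h g1) => // h2; case: n1; apply: ev_fun h1 h2.
by rewrite (H _ _ hb nb) (H _ _ hb' nb').
Qed.

Lemma env_of_shift m env : env_of m (shift_env env) = env_of (fun i => m i.+1) env.
Proof. by rewrite /env_of /shift_env -map_comp; apply: eq_map => -[]. Qed.

Lemma env_of_perm m pi env : perm_eq pi (iota 0 (size env)) ->
  [seq nth (ANum 0) (env_of m env) i | i <- pi] =
  env_of m [seq nth (ANum 0) env i | i <- pi].
Proof.
move=> h; rewrite /env_of -map_comp; apply/eq_in_map => i.
by rewrite (perm_mem h) mem_iota add0n /= => hi; rewrite (nth_map (ANum 0)).
Qed.

Section Lameness.
Variables (E : baire -> baire -> Prop) (Z : baire).
Hypothesis E_closed : closed_rel E.
Hypothesis E_answers : forall u y, answers u y <-> exists2 z, left_half z = y & E u z.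
Hypothesis Z_solvable : forall v, query_table (problem_query v) = Z ->
  (solvable E v <-> exists w, forall n, table_tree v (mkseq w n)).

(** Every good structure compatible with p claims the value of c, and this value is
    the same for all extensions of p and the structure. *)
Definition forced (p : condition) (c : config) : Prop := forall x env,
  good_struct Z x -> c.2 = env_of (member x) env ->
  (exists F, fits F p /\ agrees F x) ->
  exists2 a, claims x c.1 env a & forall F, fits F p -> agrees F x -> evo F c.1 c.2 a.

Definition probe kappa x env w : Prop :=
  [/\ good_struct Z w, meets_goal kappa w &
      env_of (member w) (shift_env env) = env_of (member x) env].

(** The reason for the refutation asked for by kappa is a true evaluation for F, so
    that skolem provides an answer with member 0 equal to g; then basis yields
    answers that are compatible with p, or with p and each other. *)
Lemma probe_ex x env p F g kappa :
  good_struct Z x -> countable_cond p -> fits F p -> agrees F x ->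
  (forall y, member y 0 = g -> env_of (member y) (shift_env env) =
      env_of (member x) env ->
     (forall e env' a, claims y e env' a -> evo F e (env_of (member y) env') a) ->
     meets_goal kappa y) ->
  exists w F', [/\ probe kappa x env w, fits F' p, agrees F' x, agrees F' w &
    (exists j, member w 0 = member x j) \/
    exists w' F'', [/\ probe kappa x env w', fits F'' p, agrees F'' x &
      [/\ agrees F'' w, agrees F'' w' & member w 0 <> member w' 0]]].
Proof.
move=> gx [en hen] Fp Fx hK.
have [N hN] := env_bound env.
pose u := query Z kappa (mkseq (member x) N).
have lay y : extends_query u y ->
    env_of (member y) (shift_env env) = env_of (member x) env.
  move=> ly; rewrite env_of_shift; apply: hN => i iN.
  by rewrite ly ?query_size_query ?size_mkseq // query_member_query nth_mkseq.
have [y [gy yF yV yL]] := skolem Z F (g :: mkseq (member x) N).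
have ly : extends_query u y.
  move=> k; rewrite query_size_query size_mkseq => kN; rewrite yL /= ?size_mkseq //.
  by rewrite query_member_query.
have /E_answers [z0 z0y Ez0] : answers u y.
  split; first by rewrite query_table_query.
  split=> //; rewrite query_goal_query; apply: hK; first by rewrite yL.
    exact: lay.
  by move=> e env' a /yV.
have Fz0 : agrees F (left_half z0) by move=> i; rewrite z0y yF.
have pr_of w : E u w -> probe kappa x env (left_half w).
  move=> Ew; have /E_answers [h1 [h2 h3]] : exists2 z,
      left_half z = left_half w & E u z by exists w.
  by split; [rewrite query_table_query in h1|rewrite query_goal_query in h3|apply: lay].
have [|z [F' [Ez F'p F'x F'z h]]] :=
  basis E_closed E_answers Z_solvable (p := fun g => exists v, p g v) gx _ Fx Ez0 Fz0.
  by exists en => g' [v /hen].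
have fp F1 : (forall g', (exists v, p g' v) -> F1 g' = F g') -> fits F1 p.
  by move=> h1 g' v pv; rewrite h1; [apply: Fp|exists v].
exists (left_half z), F'; split=> //; [exact: pr_of|exact: fp|].
case: h => [|[z' [F'' [Ez' F''p F''x h]]]]; [by left|right].
by exists (left_half z'), F''; split=> //; [apply: pr_of|apply: fp].
Qed.

Section ForcedStep.
Variables (p : condition) (x : baire) (env : seq (item nat)).
Hypothesis gx : good_struct Z x.
Hypothesis cp : countable_cond p.
Let renv := env_of (member x) env.

(** A function computed by d is in x: otherwise there are two compatible structures
    that certify different functions as the one computed by d. *)
Lemma argument_in d g F : fits F p -> agrees F x ->
  (forall F, fits F p -> agrees F x -> forall n, evo F d (ANum n :: renv) (g n)) ->
  (forall n, forced (with_struct p x) (d, ANum n :: renv)) ->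
  exists j, member x j = g.
Proof.
(* Kind false: refute every value other than those of g. *)
move=> Fp Fx hg hf; pose kappa := pickle (false, d, env).
have [|w [F' [pw F'p F'x F'w h]]] := @probe_ex x env p F g kappa gx cp Fp Fx.
  move=> y y0 ye yV b d' env' /(pcan_inj (@pickleK _)) [<- <- <-] n a /yV /=.
  by rewrite ye y0 => /ev_fun; apply; apply: hg.
have H w' F1 : probe kappa x env w' -> fits F1 p -> agrees F1 x -> agrees F1 w' ->
    member w' 0 = g.
  move=> [gw kw ew] F1p F1x F1w; apply: funext => n.
  have [||a Va ha] := hf n w' (ANum n :: shift_env env) gw.
  - by rewrite /= ew.
  - by exists F1; split=> //; apply/fits_with.
  have := kw false d env erefl n a Va => <-.
  have Fw : fits F1 (with_struct p x) by apply/fits_with.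
  exact: ev_fun (ha F1 Fw F1w) (hg F1 F1p F1x n).
have wg := H w F' pw F'p F'x F'w.
case: h => [[j ej]|[w' [F'' [pw' F''p F''x [F''w F''w' ne]]]]].
  by exists j; rewrite -ej.
by case: ne; rewrite wg (H w' F'').
Qed.

(** If the set in a call of Omega has no elements in x, then it is empty: otherwise
    there are two compatible structures that certify different elements h and
    h'. As the call converges for all F that extend p, it converges for an F
    compatible with both, for which the set would have two elements. *)
Lemma empty_call d1 d2 :
  (forall F, fits F p -> agrees F x ->
     exists a, omega_app id (evo F) [:: d1; d2] renv a) ->
  (forall j F, fits F p -> agrees F x -> evo F d1 (AFun (member x j) :: renv) 0) ->
  (forall g, forced (with_struct p x) (d1, AFun g :: renv)) ->
  forall F, fits F p -> agrees F x -> forall g, evo F d1 (AFun g :: renv) 0.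
Proof.
move=> hc h0 hf F Fp Fx g.
have [a /omega_total /(_ g) [b hb]] := hc F Fp Fx.
move=> b01; case: (eqVneq b 0) hb => [->//|/eqP nb hb]; exfalso.
(* Kind true: refute that g is outside the set. *)
pose kappa := pickle (true, d1, env).
have [|w [F' [pw F'p F'x F'w h]]] := @probe_ex x env p F g kappa gx cp Fp Fx.
  move=> y y0 ye yV b' d' env' /(pcan_inj (@pickleK _)) [<- <- <-] /yV /=.
  by rewrite ye y0 => h; apply: nb; apply: ev_fun hb h.
have H w' F1 : probe kappa x env w' -> fits F1 p -> agrees F1 x -> agrees F1 w' ->
    exists2 c, evo F1 d1 (AFun (member w' 0) :: renv) c & c <> 0.
  move=> [gw kw ew] F1p F1x F1w.
  have Fw : fits F1 (with_struct p x) by apply/fits_with.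
  have [||c Vc hcc] := hf (member w' 0) w' (AFun 0 :: shift_env env) gw.
  - by rewrite /= ew.
  - by exists F1.
  exists c; first exact: hcc.
  have nV : ~ claims w' d1 (AFun 0 :: shift_env env) 0 := kw true d1 env erefl.
  by move=> c0; rewrite /= c0 in Vc.
case: h => [[j ej]|[w' [F'' [pw' F''p F''x [F''w F''w' ne]]]]].
  have [c hcc nc] := H w F' pw F'p F'x F'w; apply: nc.
  by apply: ev_fun hcc _; rewrite ej; apply: h0.
have [c hcc nc] := H w F'' pw F''p F''x F''w.
have [c' hc' nc'] := H w' F'' pw' F''p F''x F''w'.
have [a' ha'] := hc F'' F''p F''x.
by apply: ne; apply: omega_unique ha' _ _ _ _ hcc hc' nc nc'.
Qed.

Variable e : nat.
Hypothesis hconv : converges p (e, renv).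
Hypothesis hcomp : exists F, fits F p /\ agrees F x.
Hypothesis ih : forall c', (forall F, fits F p -> agrees F x -> needs F c' (e, renv)) ->
  forced (with_struct p x) c'.

Lemma ih_struct d env' :
  (forall F, fits F p -> agrees F x -> needs F (d, env_of (member x) env') (e, renv)) ->
  exists2 a, claims x d env' a &
    forall F, fits F p -> agrees F x -> evo F d (env_of (member x) env') a.
Proof.
move=> /ih hf; have [|a Va ha] := hf x env' gx erefl.
  by have [F [F1 F2]] := hcomp; exists F; split=> //; apply/fits_with.
by exists a => // F F1 F2; apply: ha => //; apply/fits_with.
Qed.

(** The induction step. Only the functions fed to the type-2 arguments and the empty
    calls of Omega are not settled by the induction hypothesis alone. *)
Lemma forced_step : exists2 a,
  step (member x) (member_value x) (omega_app (member x)) (claims x) e env a &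
  forall F, fits F p -> agrees F x -> step id F omega_oracle (evo F) e renv a.
Proof.
have [F0 [F0p F0x]] := hcomp.
have conv F : fits F p -> exists a, step id F omega_oracle (evo F) e renv a.
  by move=> /hconv [a /(evE omega_mono)]; exists a.
move: conv ih_struct ih; rewrite /needs /step /= /renv.
case: (instr_of e) => /=.
- move=> conv _ _; have [a] := conv F0 F0p.
  by case: (env) => [|[n|?||| ] env'] //= _; exists n.+1.
- by move=> q _ _ _; exists q.
- move=> conv _ _; have [a] := conv F0 F0p.
  by case: (env) => [|[n|?||| ] env'] //= _; exists n.
- move=> d1 d2 conv ihs _.
  have [|b Vb hb] := ihs d2 env.
    by move=> F Fp Fx R a hR [b h _]; exists b.
  have [|a Va ha] := ihs d1 (ANum b :: env).
    move=> F Fp Fx R a hR [b' h h']; exists a.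
    by rewrite /= (ev_fun (hb F Fp Fx) (hR _ _ _ h)).
  by exists a => [|F Fp Fx]; exists b; [| |apply: hb|apply: ha].
- move=> d1 d2; case: (env) => [|[[|n]|?||| ] env'] /=; try by move=> conv _ _;
    case: (conv F0 F0p).
    move=> conv ihs _; have [|a Va ha] := ihs d1 env'.
      by move=> F Fp Fx R a hR h; exists a.
    by exists a.
  move=> conv ihs _; have [|b Vb hb] := ihs e (ANum n :: env').
    by move=> F Fp Fx R a hR [b h _]; exists b.
  have [|a Va ha] := ihs d2 (ANum n :: ANum b :: env').
    move=> F Fp Fx R a hR [b' h h']; exists a.
    by rewrite /= (ev_fun (hb F Fp Fx) (hR _ _ _ h)).
  by exists a => [|F Fp Fx]; exists b; [| |apply: hb|apply: ha].
- move=> d pi conv ihs _.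
  have hpi : perm_eq pi (iota 0 (size env)).
    by have [a []] := conv F0 F0p; rewrite size_map.
  rewrite size_map (env_of_perm _ hpi) in conv ihs *.
  have [|a Va ha] := ihs d [seq nth (ANum 0) env i | i <- pi].
    by move=> F Fp Fx R a hR [_ h]; exists a.
  by exists a => // F Fp Fx; split=> //; apply: ha.
- move=> i ds; rewrite onth_map; case: (onth env i) => [it|] /=; last first.
    by move=> conv; case: (conv F0 F0p).
  case: it => [n|j|||]; case: ds => [|d [|d2 [|? ?]]] //=;
    try by move=> conv; case: (conv F0 F0p).
  + move=> conv ihs _; have [|b Vb hb] := ihs d env.
      by move=> F Fp Fx R a hR [b h _]; exists b.
    by exists (member x j b) => [|F Fp Fx]; exists b => //; apply: hb.
  + move=> conv ihs ihf.
    have hn n F : fits F p -> agrees F x -> forall (R : callrel baire) a,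
        (forall e env b, R e env b -> evo F e env b) ->
        (exists2 j, forall n, R d (ANum n :: env_of (member x) env) (j n) & a = F j) ->
        exists b, R d (ANum n :: env_of (member x) env) b.
      by move=> Fp Fx R a _ [g h _]; exists (g n).
    have /choice [g hg] : forall n, exists b, claims x d (ANum n :: env) b /\
        forall F, fits F p -> agrees F x -> evo F d (ANum n :: env_of (member x) env) b.
      by move=> n; have [b] := ihs d (ANum n :: env) (hn n); exists b.
    have [||j ej] := @argument_in d g F0 F0p F0x.
    - by move=> F Fp Fx n; case: (hg n) => _; apply.
    - by move=> n; apply: ihf; apply: hn.
    exists (member_value x j) => [|F Fp Fx].
      by exists j => // n; rewrite ej; case: (hg n).
    by exists g => [n|]; [case: (hg n) => _; apply|rewrite -ej Fx].
  + move=> conv ihs ihf.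
    have hn n F : fits F p -> agrees F x -> forall (R : callrel baire) a,
        (forall e env b, R e env b -> evo F e env b) ->
        (exists2 j, forall n, R d (ANum n :: env_of (member x) env) (j n) & a =
            E2fun j) ->
        exists b, R d (ANum n :: env_of (member x) env) b.
      by move=> Fp Fx R a _ [g h _]; exists (g n).
    have /choice [g hg] : forall n, exists b, claims x d (ANum n :: env) b /\
        forall F, fits F p -> agrees F x -> evo F d (ANum n :: env_of (member x) env) b.
      by move=> n; have [b] := ihs d (ANum n :: env) (hn n); exists b.
    have [||j ej] := @argument_in d g F0 F0p F0x.
    - by move=> F Fp Fx n; case: (hg n) => _; apply.
    - by move=> n; apply: ihf; apply: hn.
    exists (E2fun g) => [|F Fp Fx].
      by exists j; rewrite ?ej // => n; case: (hg n).
    by exists g => [n|] //; case: (hg n) => _; apply.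
  + rename d into d1; move=> conv ihs ihf.
    have [|n Vn hn] := ihs d2 env.
      by move=> F Fp Fx R a hR [n h _]; exists n.
    have hd g F : fits F p -> agrees F x -> forall (R : callrel baire) a,
        (forall e env b, R e env b -> evo F e env b) ->
        omega_app id R [:: d1; d2] (env_of (member x) env) a ->
        exists b, R d1 (AFun g :: env_of (member x) env) b.
      by move=> Fp Fx R a _ /omega_total /(_ g) [b]; exists b.
    have /choice [v hv] : forall j, exists b, claims x d1 (AFun j :: env) b /\
        forall F, fits F p -> agrees F x ->
            evo F d1 (AFun (member x j) :: env_of (member x) env) b.
      by move=> j; have [b] := ihs d1 (AFun j :: env) (hd (member x j)); exists b.
    have hvE F j b : fits F p -> agrees F x ->
        evo F d1 (AFun (member x j) :: env_of (member x) env) b -> v j = b.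
      by move=> Fp Fx; apply: ev_fun; case: (hv j) => _; apply.
    (* A point of x inside the set settles the call; otherwise the set has to be
       empty. *)
    case: (pselect (exists j, v j <> 0)) => [[j0 nj0]|all0].
      have key F : fits F p -> agrees F x ->
          evo F d1 (AFun (member x j0) :: env_of (member x) env) 1 /\
          forall g, evo F d1 (AFun g :: env_of (member x) env) 0 \/ g = member x j0.
        move=> Fp Fx; have [a [n' _ h]] := conv F Fp.
        case: h => [[g0 h0 [h _]]|[h _]]; last by case: nj0; apply: hvE (h _).
        have e0 : member x j0 = g0 by case: (h (member x j0)) => // h'; case: nj0;
            apply: hvE h'.
        by rewrite e0.
      have [k1 k2] := key F0 F0p F0x.
      exists (seqcode [:: member x j0] n) => [|F Fp Fx]; exists n => //; try exact: hn.
        left; exists j0; first by rewrite -(hvE F0 j0 1) //; case: (hv j0).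
        split=> // j; case: (k2 (member x j)) => [h|->]; [left|by right].
        by rewrite -(hvE F0 j 0) //; case: (hv j).
      by have [k3 k4] := key F Fp Fx; left; exists (member x j0).
    have v0 j : v j = 0 by apply: contrapT => nj; apply: all0; exists j.
    have emp : forall F, fits F p -> agrees F x ->
        forall g, evo F d1 (AFun g :: env_of (member x) env) 0.
      apply: (@empty_call d1 d2) => [F Fp Fx|j F Fp Fx|g].
      - exact: conv.
      - by rewrite -(v0 j); case: (hv j) => _; apply.
      - by apply: ihf; apply: hd.
    exists (seqcode [::] n) => [|F Fp Fx]; exists n => //; try exact: hn.
      by right; split=> // j; rewrite -(v0 j); case: (hv j).
    by right; split=> // g; apply: emp.
- move=> k; case: (env) => [|[m|?||| ] env'] /=; try by move=> conv;
    case: (conv F0 F0p).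
  move=> conv ihs _; have [a0 [hk _]] := conv F0 F0p; rewrite size_map in hk.
  have [|a Va ha] := ihs m (take k env').
    by move=> F Fp Fx R a hR [_ h]; exists a; rewrite /env_of map_take.
  exists a => // F Fp Fx; split; first by rewrite size_map.
  by rewrite -map_take; apply: ha.
- by move=> conv; case: (conv F0 F0p).
Qed.

End ForcedStep.

Lemma converges_forced p c : countable_cond p -> converges p c ->
    (exists F, fits F p) -> forced p c.
Proof.
move=> cp hc hF; have A := below_acc hF hc.
have [y ey] : exists y, y = (p, c) by eexists.
rewrite -ey in A; elim: A p c cp hc hF ey => {}y _ ih p [e renv] cp hc hF ey.
move=> x env gx /= erenv hcomp; subst renv.
have [|a h1 h2] := @forced_step p x env gx cp e hc hcomp.
  move=> c' hc'; have hF' : exists F, fits F (with_struct p x).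
    by have [F [F1 F2]] := hcomp; exists F; apply/fits_with.
  apply: (ih (with_struct p x, c')) => //.
  - rewrite ey; split; first by move=> g v; left.
    by split=> // F /fits_with [Fp Fx]; apply: hc'.
  - exact: countable_with.
  move=> F /fits_with [Fp Fx]; have [a /(evE omega_mono) h] := hc F Fp.
  by have [b] := hc' F Fp Fx _ _ (fun _ _ _ => id) h; exists b.
exists a; first by case: gx => _ [h _]; apply: h.
by move=> F Fp Fx; apply: evI; apply: h2.
Qed.

End Lameness.

(** Any good structure on which F is given determines the value. Totality enters as
    convergence for all extensions of the empty condition. *)
Lemma countably_based (P : (baire -> nat) -> nat) e :
  (forall F, evo F e [:: ATwo; AThree; AE2] (P F)) ->
  forall F, exists m : nat -> baire,
    forall F', (forall k, F' (m k) = F (m k)) -> P F' = P F.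
Proof.
move=> hP F; have [E [Z [E_closed E_answers Z_solvable]]] := tree_table.
have [x [gx xF xV _]] := skolem Z F [::].
pose p : condition := fun _ _ => False.
have L : forced Z p (e, [:: ATwo; AThree; AE2]).
  apply: (converges_forced E_closed E_answers Z_solvable);
      first by exists (fun=> zero_point).
    by move=> F' _; exists (P F').
  by exists F.
have fp F' : fits F' p by [].
have Fx : agrees F x by move=> i; rewrite xF.
have [|a _ ha] := L x [:: ATwo; AThree; AE2] gx erefl; first by exists F.
exists (member x) => F' hF'.
have F'x : agrees F' x by move=> i; rewrite hF' xF.
by rewrite (ev_fun (hP F') (ha F' (fp F') F'x)) (ev_fun (hP F) (ha F (fp F) Fx)).
Qed.

(** * No countably based functional computes Omega *)

(** Agreement on N suffices also at the calls of a functional P of type 3 provided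
    that N contains a base for each of them. *)
Lemma phi_agree (P : (baire -> nat) -> nat) (N : baire -> Prop) (X X' : baire -> nat) :
  (forall g, N g -> X g = X' g) ->
  (forall d env g, reals_in N env ->
     (forall n, ev X (phi_app P) d (ANum n :: env) (g n)) -> N g) ->
  (forall d env G G', reals_in N env ->
     (forall g, ev X (phi_app P) d (AFun g :: env) (G g)) ->
     (forall g, N g -> G' g = G g) -> P G' = P G) ->
  forall e env a b, reals_in N env ->
    ev X (phi_app P) e env a -> ev X' (phi_app P) e env b -> a = b.
Proof.
move=> hX hN hP e env a b oe ha;
    apply: (@ev_agree N X X' (phi_app P) (phi_app P) (@phi_mono P) hX hN _) ha b oe.
move=> R R' [|d [|? ?]] // env' a' b' oe' hR hRR [G hG ->] [G' hG' ->].
apply/esym; apply: (hP d env') => // [g|g Ng]; first by apply: hR.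
by apply/esym; apply: hRR (hG g) (hG' g); apply: reals_in_Fun.
Qed.

Lemma phi_fun P X e env a b :
  ev X (phi_app P) e env a -> ev X (phi_app P) e env b -> a = b.
Proof.
apply: (@phi_agree P (fun=> True) X X) => //; last by move=> i; case: nth.
by move=> d env' G G' _ _ h; congr P; apply: funext => g; apply: h.
Qed.

Lemma reals_in_env_of m env : reals_in (fun g => exists i, m i = g) env ->
  exists env', env = env_of m env'.
Proof.
elim: env => [|t env ih] o; first by exists [::].
have [env' ->] := ih (reals_in_behead o).
have := o 0; case: t {o} => [n|g|||] /=.
- by exists (ANum n :: env').
- by case=> i <-; exists (AFun i :: env').
- by exists (ATwo :: env').
- by exists (AE2 :: env').
- by exists (AThree :: env').
Qed.

(** Each call and each computed function with parameters in N adds countably many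
    points, and there are countably many of them. *)
Lemma closed_countable_set (P : (baire -> nat) -> nat) (X : baire -> nat) :
  (forall F, exists m : nat -> baire,
    forall F', (forall k, F' (m k) = F (m k)) -> P F' = P F) ->
  exists m : nat -> baire, let N g := exists i, m i = g in
    (forall d env g, reals_in N env ->
      (forall n, ev X (phi_app P) d (ANum n :: env) (g n)) -> N g) /\
    (forall d env G G', reals_in N env ->
      (forall g, ev X (phi_app P) d (AFun g :: env) (G g)) ->
      (forall g, N g -> G' g = G g) -> P G' = P G).
Proof.
move=> hP.
have /choice [B hB] : forall c : config, exists m : nat -> baire, forall G G',
    (forall g, ev X (phi_app P) c.1 (AFun g :: c.2) (G g)) ->
    (forall k, G' (m k) = G (m k)) -> P G' = P G.
  move=> [d env] /=.
  case: (pselect (exists G, forall g,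
      ev X (phi_app P) d (AFun g :: env) (G g))) => [[G hG]|h].
    have [m hm] := hP G; exists m => G1 G' hG1.
    have -> : G1 = G by apply: funext => g; apply: phi_fun (hG1 g) (hG g).
    exact: hm.
  by exists (fun=> zero_point) => G G' hG; case: h; exists G.
pose Req (t : nat * seq (item nat) + nat * seq (item nat) * nat) L r := match t with
  | inl (d, env) => forall g,
      (forall n, ev X (phi_app P) d (ANum n ::
          env_of (nth zero_point L) env) (g n)) -> r = g
  | inr (d, env, k) => r = B (d, env_of (nth zero_point L) env) k
  end.
have [|m [_ hm]] := @enum_demands _ Req [::].
  case=> [[d env]|[[d env] k]] L /=; last by eexists.
  case: (pselect (exists g, forall n,
    ev X (phi_app P) d (ANum n :: env_of (nth zero_point L) env) (g n))) => [[g hg]|h].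
    by exists g => g' hg'; apply: funext => n; apply: phi_fun (hg n) (hg' n).
  by exists zero_point => g hg; case: h; exists g.
have env_nth env : exists N, env_of (nth zero_point (mkseq m N)) env = env_of m env.
  have [N hN] := env_bound env; exists N; apply: hN => i iN.
  by rewrite nth_mkseq.
exists m; split.
  move=> d env g /reals_in_env_of [env' ->] hg; have [N hN] := env_nth env'.
  by have [j /=] := hm (inl (d, env')) N; rewrite hN => /(_ g hg); exists j.
move=> d env G G' /reals_in_env_of [env' ->] hG hG';
    apply: (hB (d, env_of m env')) => // k.
apply: hG'; have [N hN] := env_nth env'.
by have [j /=] := hm (inr (d, env', k)) N; rewrite hN => ?; exists j.
Qed.

Theorem theorem3p46 :
  ~ exists Phi : Par (pure 3),
      [/\ is_total (pure 3) Phi,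
          computable_in (pure 3) Phi
            [:: oracle (pure 2 ⇒ TN ⇒ TN) Omega; oracle (pure 2) E2]
        & computable_in (pure 2 ⇒ TN ⇒ TN) Omega
            [:: oracle (pure 3) Phi; oracle (pure 2) E2]].
Proof.
case=> Phi [tPhi [c hc] [e he]].
pose P (G : baire -> nat) := odflt 0 (Phi G).
have PE : Phi = fun G => Some (P G).
  apply: funext => G; rewrite /P; have /= := tPhi (G, tt).
  by case: (Phi G).
have based : forall F, exists m : nat -> baire,
    forall F', (forall k, F' (m k) = F (m k)) -> P F' = P F.
  apply: (@countably_based P c) => F.
  have h : papp (s := pure 3) Phi (F, tt) = Some (P F) by rewrite PE.
  exact: (@kleene_omega F c [:: ATwo; AThree; AE2] _ (hc (F, tt) _ h)).
pose X0 (g : baire) := 0; have [m [hm1 hm2]] := closed_countable_set X0 based.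
(* A real outside the countable set, by diagonalization. *)
pose f n := (m n n).+1; pose X1 (g : baire) : nat := `[< g = f >].
have fm i : m i <> f by move=> /(congr1 (fun g : baire => g i)) /= /n_Sn.
have run X a : papp (s := pure 2 ⇒ TN ⇒ TN) Omega (X, (0, tt)) = Some a ->
    ev X (phi_app P) e [:: ATwo; ANum 0; AThree; AE2] a.
  move=> h; apply: kleene_phi.
  by have := he (X, (0, tt)) a h; rewrite PE.
have O0 : papp (s := pure 2 ⇒ TN ⇒ TN) Omega (X0, (0, tt)) = Some 0.
  rewrite /= /Omega elements0 //; case: asboolP => // -[].
  by split=> [g|g g'] //; left.
have X1f g : X1 g = 1 <-> g = f by rewrite /X1; case: asboolP.
have O1 : papp (s := pure 2 ⇒ TN ⇒ TN) Omega (X1, (0, tt)) = Some 1.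
  rewrite /= /Omega (elements1 X1f); case: asboolP => // -[].
  split=> [g|g g' /X1f -> /X1f -> //].
  by rewrite /X1; case: asboolP; [right|left].
have hX : forall g, (exists i, m i = g) -> X0 g = X1 g.
  by move=> g [i <-]; rewrite /X1; case: asboolP => // /fm.
suff : 0 = 1 by [].
apply: (@phi_agree P _ X0 X1 hX hm1 hm2 e _ _ _ _ (run _ _ O0) (run _ _ O1)).
by case=> [|[|[|[|i]]]] //=; rewrite nth_nil.
Qed.
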